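(* Let $D$ be a $\mathbb{Z}$-free chain complex concentrated in positive dimensions. Let $c:\lceil \mathcal{C}(\tilde\Gamma D)\rceil\to\{\tilde\Gamma D\}$ be the chain map that is the $\mathbb{Z}$-linear extension of the map sending the generator $[z]$ corresponding to a simplex $z$ of $\tilde\Gamma D$ to the element $z$ of $\{\tilde\Gamma D\}$, and let $$\gamma_D:\mathcal{C}(\tilde\Gamma D)\to P_{\mathfrak{S}}\{\tilde\Gamma D\}$$ be the morphism of $\mathfrak{S}$-coalgebras induced by $c$ (the classifying map of $c$). Then $\gamma_D$ is injective.
   Context: **Barratt–Eccles operad and coalgebras.** $\mathfrak{S}$ is the Barratt–Eccles operad of chain complexes: $\mathfrak{S}(0)=\mathbb{Z}$ and, for $n\ge1$, $\mathfrak{S}(n)=RS_n$ is the bar resolution of $\mathbb{Z}$ over $\mathbb{Z}S_n$ (with free $\mathbb{Z}S_n$-basis the symbols $[g_1|\cdots|g_m]$ in degree $m$), with its standard operad structure. An $\mathfrak{S}$-coalgebra is a chain complex $C$ with an operad morphism $\mathfrak{S}\to\mathrm{CoEnd}(C)$, $\mathrm{CoEnd}(C)(n)=\mathrm{Hom}_{\mathbb{Z}}(C,C^{\otimes n})$; equivalently compatible structure maps $RS_n\otimes C\to C^{\otimes n}$, with adjoints $a_n:C\to\mathrm{Hom}_{\mathbb{Z}S_n}(RS_n,C^{\otimes n})$; the arity-$0$ structure map is an augmentation $C\to\mathbb{Z}$. An element $c\in C$ is group-like if $a_n(c)(x)=\epsilon_n(x)\,c^{\otimes n}$ for all $n>0$,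 where $\epsilon_n:RS_n\to\mathbb{Z}$ is the augmentation. $C$ is pointed if it has a unique group-like element $1$, and pointed irreducible if moreover the intersection of any two sub-coalgebras contains $1$. For a pointed irreducible $C$, $\lceil C\rceil$ is the chain complex $\ker(C\to\mathbb{Z})$. **The coalgebra $\mathcal{C}(X)$.** For a pointed, reduced (one vertex) simplicial set $X$, $\tilde{\mathbb{Z}}X=\mathbb{Z}X/\mathbb{Z}*$ is the pointed free simplicial abelian group. For a simplicial abelian group $A$, $\{A\}$ is its (unnormalized) Moore complex: $\{A\}_m=A_m$ with differential $\sum(-1)^id_i$. $\mathcal{C}(X)$ is the integral chain complex of $X$ with $\lceil\mathcal{C}(X)\rceil=\{\tilde{\mathbb{Z}}X\}$ (unnormalized chains, with positive-dimensional degeneracies of the basepoint set to $0$), equipped with the natural $\mathfrak{S}$-coalgebra structure constructed by J. R. Smith (''Iterating the cobar construction'', Mem. AMS 1994) by acyclic models on simplices, the one used to define Steenrod operations. It is defined simplex by simplex through maps $f:RS_n\otimes C(\Delta^k)\to C(\Delta^k)^{\otimes n}$, natural for face inclusions: $f([\,]\otimes-)$ is the (iterated) Alexander–Whitney coproduct, and for a bar basis element $e$ of degree $m\ge1$, $f(e\otimes\Delta^k)=\Phi_k\bigl(f(\partial e\otimes\Delta^k)+(-1)^mf(e\otimes\partial\Delta^k)\bigr)$, where $\Phi_k$ is the contraction of the tensor power ($\varphi_k\otimes1+i\epsilon\otimes\varphi_k$ for $n=2$) built from $\varphi_k[i_0,\dots,i_t]=(-1)^{t+1}[i_0,\dots,i_t,k]$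 if $i_t\neq k$ and $0$ otherwise, and $i\epsilon$ is the augmentation followed by $1\mapsto[k]$. **Other notation.** $\tilde\Gamma D=\Gamma D$ is the Dold–Kan simplicial abelian group of $D$, pointed by $0$. For a $\mathbb{Z}$-free chain complex $E$ in positive dimensions, $P_{\mathfrak{S}}E$ is the pointed irreducible cofree $\mathfrak{S}$-coalgebra on $E$: it comes with a chain map $\varepsilon:\lceil P_{\mathfrak{S}}E\rceil\to E$ such that for every pointed irreducible $\mathfrak{S}$-coalgebra $C$ and chain map $f:\lceil C\rceil\to E$ there is a unique coalgebra morphism $\alpha_f:C\to P_{\mathfrak{S}}E$ (the classifying map of $f$) with $\varepsilon\circ\lceil\alpha_f\rceil=f$. *)

(* Defs.v *)
From HB Require Import structures.
From mathcomp Require Import all_boot all_order all_algebra all_fingroup.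
From mathcomp Require Import generic_quotient ring_quotient boolp zify.
From mathcomp.multinomials Require Import freeg.

Set Implicit Arguments.
Unset Strict Implicit.
Unset Printing Implicit Defensive.

Import Order.TTheory GRing.Theory Num.Theory Quotient.
Local Open Scope ring_scope.
Local Open Scope quotient_scope.

(** * Free abelian groups *)

Definition fg (T : choiceType) : zmodType := {freeg T / int}.
Definition fgen (T : choiceType) (x : T) : fg T := [freeg [:: (1, x)]].

(* Z-linear extension of a map defined on a basis *)
Definition lin (T : choiceType) (V : zmodType) (f : T -> V) (u : fg T) : V :=
  \sum_(x <- dom u) f x *~ coeff x u.

Section LinTheory.
Context (T : choiceType) (V : zmodType) (f : T -> V).

Lemma lin_dom (s : seq T) (u : fg T) :
  uniq s -> {subset dom u <= s} -> lin f u = \sum_(x <- s) f x *~ coeff x u.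
Proof.
move=> us sub; rewrite /lin [RHS](bigID (fun x => x \in dom u)) /=.
rewrite [X in _ + X]big1 ?addr0; last first.
  by move=> x xu; rewrite coeff_outdom // mulr0z.
rewrite -[RHS]big_filter; apply/perm_big/uniq_perm.
- exact: uniq_dom.
- exact: filter_uniq.
by move=> x; rewrite mem_filter andb_idr // => /sub.
Qed.

Lemma lin_is_zmod_morphism : zmod_morphism (lin f).
Proof.
move=> u v; set s := undup (dom u ++ dom v).
rewrite !(@lin_dom s) ?undup_uniq //; last 3 first.
- by move=> x xd; rewrite mem_undup mem_cat xd orbT.
- by move=> x xd; rewrite mem_undup mem_cat xd.
- by move=> x /domB; rewrite mem_undup.
rewrite -sumrB; apply: eq_bigr => x _.
by rewrite coeffB mulrzBr.
Qed.

HB.instance Definition _ :=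
  GRing.isZmodMorphism.Build (fg T) V (lin f) lin_is_zmod_morphism.

Lemma lin_gen x : lin f (fgen x) = f x.
Proof.
by rewrite /lin domU1 big_seq1 /fgen coeffU eqxx mulr1 mulr1z.
Qed.

End LinTheory.

Lemma fg_sum (T : choiceType) (u : fg T) :
  u = \sum_(x <- dom u) fgen x *~ coeff x u.
Proof.
rewrite -[LHS]freeg_sumE; apply: eq_bigr => x _.
by rewrite freegU_mulz intz.
Qed.

Lemma lin_ext (T : choiceType) (V : zmodType) (g h : {additive fg T -> V}) :
  (forall x, g (fgen x) = h (fgen x)) -> forall u, g u = h u.
Proof.
move=> gh u; rewrite [u]fg_sum !raddf_sum; apply: eq_bigr => x _.
by rewrite !raddfMz gh.
Qed.

(* The free abelian group on [T] modulo the generators satisfying [z]. *)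
Definition pfree (T : choiceType) (z : pred T) : zmodType :=
  fg {x : T | ~~ z x}.

Definition pgen (T : choiceType) (z : pred T) (x : T) : pfree z :=
  if insub x is Some y then fgen y else 0.

Definition plin (T : choiceType) (z : pred T) (V : zmodType) (f : T -> V)
  : pfree z -> V := lin (fun y => f (val y)).

HB.instance Definition _ (T : choiceType) (z : pred T) (V : zmodType)
  (f : T -> V) :=
  GRing.Additive.copy (@plin T z V f) (lin (fun y => f (val y))).

Lemma pgen0 (T : choiceType) (z : pred T) x : z x -> pgen z x = 0.
Proof. by move=> zx; rewrite /pgen insubN // zx. Qed.

Lemma plin_gen (T : choiceType) (z : pred T) (V : zmodType) (f : T -> V) x :
  plin f (pgen z x) = if z x then 0 else f x.
Proof.
case: ifPn => zx; first by rewrite pgen0 // raddf0.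
by rewrite /pgen insubT /plin lin_gen.
Qed.

Lemma plin_genE (T : choiceType) (z : pred T) (V : zmodType) (f : T -> V) x :
  (z x -> f x = 0) -> plin f (pgen z x) = f x.
Proof. by move=> h; rewrite plin_gen; case: ifP => // /h. Qed.

Lemma pgen_val (T : choiceType) (z : pred T) (y : {x : T | ~~ z x}) :
  pgen z (val y) = fgen y.
Proof. by rewrite /pgen valK. Qed.

Lemma plin_ext (T : choiceType) (z : pred T) (V : zmodType)
  (g h : {additive pfree z -> V}) :
  (forall x, g (pgen z x) = h (pgen z x)) -> forall u, g u = h u.
Proof. by move=> gh; apply: lin_ext => x; rewrite -pgen_val. Qed.

Definition zfree (V : zmodType) : Prop :=
  exists (T : choiceType) (phi : {additive V -> fg T}), bijective phi.

Definition triv : zmodType := fg void.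

Lemma triv0 (x : triv) : x = 0.
Proof. by rewrite [x]fg_sum big1_seq // => -[]. Qed.

(** * Chain complexes *)

(* [ipred k] is [k - 1]; it is written by cases so that
   [ipred (Posz m.+1)] computes to [Posz m]. *)
Definition ipred (k : int) : int :=
  match k with
  | Posz 0 => Negz 0
  | Posz m.+1 => Posz m
  | Negz m => Negz m.+1
  end.

Lemma ipredE k : ipred k = k - 1.
Proof. by case: k => [[|m]|m] /=; lia. Qed.

Record chcx := ChCx {
  cc :> int -> zmodType;
  cd : forall k, {additive cc k -> cc (ipred k)};
  cdd : forall k x, cd (ipred k) (cd k x) = 0
}.

Record chmap (C E : chcx) := ChMap {
  cm :> forall k, {additive C k -> E k};
  cmd : forall k x, cm (ipred k) (cd C k x) = cd E k (cm k x)
}.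

Definition zfree_cx (D : chcx) : Prop := forall k, zfree (D k).

Definition positive_cx (D : chcx) : Prop :=
  forall k : int, k <= 0 -> forall x : D k, x = 0.

Section NatGraded.
Context (A : nat -> zmodType) (d : forall m, {additive A m.+1 -> A m}).
Hypothesis dd : forall m x, d m (d m.+1 x) = 0.

Definition ncc (k : int) : zmodType :=
  match k with Posz m => A m | Negz _ => triv end.

Definition ncd (k : int) : {additive ncc k -> ncc (ipred k)} :=
  match k return {additive ncc k -> ncc (ipred k)} with
  | Posz 0 => \0
  | Posz m.+1 => d m
  | Negz m => \0
  end.

Lemma ncdd k x : ncd (ipred k) (ncd k x) = 0.
Proof. by case: k x => [[|[|m]]|m] x //=; apply: dd. Qed.

Definition natcx : chcx := ChCx ncdd.
End NatGraded.

Lemma alternating_sum0 (V : zmodType) (m : nat) (F : nat -> nat -> V) :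
  (forall i j, (j < i <= m.+2)%N -> F i j = F j i.-1) ->
  \sum_(i < m.+3) \sum_(j < m.+2) F i j *~ ((-1) ^+ (i + j)) = 0.
Proof.
move=> FE; pose G (i j : nat) := F i j *~ ((-1) ^+ (i + j)).
rewrite (eq_bigr (fun i : 'I_m.+3 => \sum_(j < m.+2) G i j)) //.
rewrite pair_big /= (bigID (fun p : 'I_m.+3 * 'I_m.+2 => (p.2 < p.1)%N)) /=.
pose h (p : 'I_m.+3 * 'I_m.+2) : 'I_m.+3 * 'I_m.+2 := (inord p.2, inord p.1.-1).
pose h' (p : 'I_m.+3 * 'I_m.+2) : 'I_m.+3 * 'I_m.+2 := (inord p.2.+1, inord p.1).
rewrite [X in _ + X](reindex_onto h h') /=; last first.
  move=> [i j] /= ji; have := ltn_ord i; have := ltn_ord j => jm im.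
  by rewrite /h /h'; congr pair; apply: val_inj; rewrite /= !inordK //; lia.
rewrite [X in _ + X](eq_big (fun p : 'I_m.+3 * 'I_m.+2 => (p.2 < p.1)%N)
  (fun p => - G p.1 p.2)); first by rewrite sumrN addrN.
- move=> [i j] /=; have := ltn_ord i; have := ltn_ord j => jm im.
  rewrite (inordK (_ : (j < m.+3)%N)); last lia.
  rewrite (inordK (_ : (i.-1 < m.+2)%N)); last lia.
  apply/andP/idP => [[lt /eqP[] /(congr1 val)]|lt].
    by rewrite /= !inordK; try lia; move=> iE _; lia.
  split; first lia.
  by apply/eqP; congr pair; apply: val_inj; rewrite /= !inordK //; lia.
move=> [i j] /= /andP[]; have := ltn_ord i; have := ltn_ord j => jm im.
rewrite (inordK (_ : (j < m.+3)%N)); last lia.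
rewrite (inordK (_ : (i.-1 < m.+2)%N)); last lia.
move=> lt /eqP[] /(congr1 val) /=; rewrite !inordK; try lia.
move=> iE _; rewrite /G -FE; last lia.
have -> : (i + j)%N = (j + i.-1).+1 by lia.
by rewrite exprS mulN1r mulrNz opprK.
Qed.

Section Kernel.
Context (A B : zmodType) (f : {additive A -> B}).

Definition kpred : pred A := fun x => f x == 0.

Lemma kpred_zmod_closed : zmod_closed kpred.
Proof.
split=> [|x y]; rewrite !unfold_in /kpred ?raddf0 //.
by move=> /eqP fx /eqP fy; rewrite raddfB fx fy subrr.
Qed.
HB.instance Definition _ := GRing.isZmodClosed.Build A kpred kpred_zmod_closed.

Definition ker_of := {x : A | kpred x}.
HB.instance Definition _ := SubChoice.on ker_of.
HB.instance Definition _ := [SubChoice_isSubZmodule of ker_of by <:].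

Definition ker_in (x : A) (fx : f x = 0) : ker_of := exist _ x (introT eqP fx).

Lemma ker_out (x : ker_of) : f (val x) = 0.
Proof. exact/eqP/(valP x). Qed.
End Kernel.

(** * Tensor powers *)

(* homogeneous elements of a complex *)
Definition elt (C : int -> zmodType) : choiceType := {k : int & C k}.
Definition el (C : int -> zmodType) k (x : C k) : elt C :=
  Tagged (fun k => C k) x.
Definition el0 (C : int -> zmodType) : elt C := @el C 0 0.

Section TensorPower.
Context (C : int -> zmodType) (n : nat).

Definition word (s : seq (elt C)) : fg (n.-tuple (elt C)) :=
  if insub s is Some t then fgen t else 0.

Inductive mlrel : fg (n.-tuple (elt C)) -> Prop :=
| mlrel0 : mlrel 0
| mlrelB u v : mlrel u -> mlrel v -> mlrel (u - v)
| mlrelD s1 s2 k (a b : C k) :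
    mlrel (word (s1 ++ el (a + b) :: s2)
           - (word (s1 ++ el a :: s2) + word (s1 ++ el b :: s2))).

Definition mlpred : pred (fg (n.-tuple (elt C))) := fun u => `[< mlrel u >].

Lemma mlpred_zmod_closed : zmod_closed mlpred.
Proof.
split=> [|u v]; rewrite !unfold_in; first by apply/asboolP; constructor.
by move=> /asboolP mu /asboolP mv; apply/asboolP; constructor.
Qed.
HB.instance Definition _ :=
  GRing.isZmodClosed.Build (fg (n.-tuple (elt C))) mlpred mlpred_zmod_closed.

(* [tpow C n] is the n-th tensor power over Z of the direct sum of the [C k];
   its grading is recorded by [thom] below. *)
Definition tpow : zmodType := {quot (GRing.ZmodClosed.clone _ mlpred _)}.

Definition tpi (u : fg (n.-tuple (elt C))) : tpow := \pi_tpow u.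

Lemma tpi_is_zmod_morphism : zmod_morphism tpi.
Proof. by move=> u v; rewrite /tpi raddfB. Qed.
HB.instance Definition _ :=
  GRing.isZmodMorphism.Build _ tpow tpi tpi_is_zmod_morphism.

(* the elementary tensor of the word [s], which must have length [n] *)
Definition tens (s : seq (elt C)) : tpow := tpi (word s).

Definition thom (d : int) (x : tpow) : Prop :=
  exists2 u, x = tpi u & {in dom u, forall t, \sum_(e <- tval t) tag e = d}.

Definition multilin (V : zmodType) (f : seq (elt C) -> V) : Prop :=
  forall s1 s2 k (a b : C k), (size s1 + size s2).+1 = n ->
    f (s1 ++ el (a + b) :: s2) = f (s1 ++ el a :: s2) + f (s1 ++ el b :: s2).

(* The additive map on the tensor power induced by a multilinear [f]. *)
Definition tlift (V : zmodType) (f : seq (elt C) -> V) (x : tpow) : V :=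
  lin (fun t : n.-tuple (elt C) => f t) (repr x).

Lemma lin_word (V : zmodType) (f : seq (elt C) -> V) s :
  lin (fun t : n.-tuple (elt C) => f t) (word s)
  = if size s == n then f s else 0.
Proof.
rewrite /word; case: insubP => [t /= -> st|/negbTE ->]; last by rewrite raddf0.
by rewrite lin_gen st.
Qed.

Lemma tlift_pi (V : zmodType) (f : seq (elt C) -> V) : multilin f ->
  forall u, tlift f (tpi u) = lin (fun t : n.-tuple (elt C) => f t) u.
Proof.
move=> ml u; rewrite /tlift; apply/eqP; rewrite -subr_eq0 -raddfB; apply/eqP.
have : mlpred (repr (tpi u) - u).
  have := idealrBE (GRing.ZmodClosed.clone _ mlpred _) (repr (tpi u)) u.
  by rewrite reprK eqxx => /idP.
move/asboolP; elim=> [|v w _ hv _ hw|s1 s2 k a b].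
- by rewrite raddf0.
- by rewrite raddfB /= hv hw subrr.
rewrite raddfB raddfD /= !lin_word !size_cat /= !addnS.
by case: eqP => [/ml ->|_]; rewrite ?addr0 subrr.
Qed.

Lemma tlift_tens (V : zmodType) (f : seq (elt C) -> V) s :
  multilin f -> size s = n -> tlift f (tens s) = f s.
Proof. by move=> ml sn; rewrite tlift_pi // lin_word sn eqxx. Qed.

Lemma tlift_is_zmod_morphism (V : zmodType) (f : seq (elt C) -> V) :
  multilin f -> zmod_morphism (tlift f).
Proof.
move=> ml x y; rewrite -[x]reprK -[y]reprK.
change (tlift f (tpi (repr x) - tpi (repr y))
        = tlift f (tpi (repr x)) - tlift f (tpi (repr y))).
by rewrite -raddfB !tlift_pi // raddfB.
Qed.

Lemma tens_multilin : multilin tens.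
Proof.
move=> s1 s2 k a b _; rewrite /tens -raddfD; apply/eqP.
rewrite /tpi -idealrBE; apply/asboolP; exact: mlrelD.
Qed.
End TensorPower.

Definition sgn (n : nat) : int := (-1) ^+ n.

Definition edeg (C : int -> zmodType) (e : elt C) : nat := `|tag e|%N.
Definition wdeg (C : int -> zmodType) (s : seq (elt C)) : nat :=
  (\sum_(e <- s) edeg e)%N.

(* Koszul sign of replacing x_0 ... x_(n-1), of degrees [deg i], by
   x_(s 0) ... x_(s (n-1)). *)
Definition koszul n (s : 'S_n) (deg : nat -> nat) : int :=
  \prod_(i < n) \prod_(j < n | (i < j)%N && (s j < s i)%N)
    sgn (deg (s i) * deg (s j)).

Definition permute (T : Type) n (s : 'S_n) (x0 : T) (t : seq T) : seq T :=
  [seq nth x0 t (s j) | j <- enum 'I_n].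

Section TensorMaps.
Context (C : int -> zmodType) (n : nat).

(* x_0 (x) ... (x) x_(n-1) |-> +- x_(s 0) (x) ... (x) x_(s (n-1)); this is a
   left action, since in 'S_n the product [s * t] is [t \o s] *)
Definition tperm_act (s : 'S_n) : tpow C n -> tpow C n :=
  tlift (fun t => tens n (permute s (el0 C) t)
                  *~ koszul s (fun j => edeg (nth (el0 C) t j))).

Definition tmap (P : int -> zmodType) (g : forall k, C k -> P k)
  : tpow C n -> tpow P n :=
  tlift (fun t => tens n [seq el (g (tag e) (tagged e)) | e <- t]).

(* 1 (x) ... (x) phi (x) ... (x) 1 with [phi], of degree [q], in place [i] *)
Definition tins (i q m : nat) (phi : forall k, C k -> tpow C m) (N : nat)
  : tpow C n -> tpow C N :=
  tlift (fun t =>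
    let e := nth (el0 C) t i in
    tlift (fun u => tens N (take i t ++ u ++ drop i.+1 t)) (phi (tag e) (tagged e))
    *~ sgn (q * wdeg (take i t))).
End TensorMaps.

Definition tdiff (C : chcx) n : tpow C n -> tpow C n :=
  tlift (fun t => \sum_(i < n)
    let e := nth (el0 C) t i in
    tens n (take i t ++ el (cd C (tag e) (tagged e)) :: drop i.+1 t)
    *~ sgn (wdeg (take i t))).

Lemma tmap_multilin (C P : int -> zmodType) n (g : forall k, {additive C k -> P k}) :
  @multilin C n _ (fun t : seq (elt C) =>
    tens n [seq el (g (tag e) (tagged e)) : elt P | e <- t]).
Proof.
move=> s1 s2 k a b sn; rewrite !map_cat /= raddfD.
by apply: tens_multilin; rewrite !size_map.
Qed.

Lemma tmap0 (C P : int -> zmodType) n (g : forall k, {additive C k -> P k}) :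
  tmap g 0 = 0 :> tpow P n.
Proof.
have am := tlift_is_zmod_morphism (@tmap_multilin C P n g).
by have := am 0 0; rewrite subrr /tmap => ->; rewrite subrr.
Qed.

(** * The Barratt-Eccles operad *)

(* [RS n] is the (normalized) bar resolution of Z over Z['S_n]: it is free
   over Z on the elements g[g_1|...|g_m], encoded as (g, [:: g_1; ...; g_m]),
   and the symbols with some g_i = 1 are zero.  Without this normalization the
   arities 0 (where S(0) = Z) and n > 0 would not fit into one operad. *)
Definition RS n : zmodType :=
  pfree (fun x : 'S_n * seq 'S_n => 1%g \in x.2).

Definition bar n (g : 'S_n) (gs : seq 'S_n) : RS n := pgen _ (g, gs).

Definition RSact n (h : 'S_n) : RS n -> RS n :=
  plin (fun x => bar (h * x.1)%g x.2).

(* d [g_1|...|g_m] = g_1[g_2|...|g_m]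
     + sum_(0 < i < m) (-1)^i [...|g_i g_(i+1)|...] + (-1)^m [g_1|...|g_(m-1)] *)
Definition bar_diff n (gs : seq 'S_n) : RS n :=
  if gs is g1 :: gs' then
    bar g1 gs'
    + \sum_(1 <= i < size gs)
        bar 1%g (take i.-1 gs ++ (nth 1 gs i.-1 * nth 1 gs i)%g :: drop i.+1 gs)
        *~ sgn i
    + bar 1%g (take (size gs).-1 gs) *~ sgn (size gs)
  else 0.

Definition RSdiff n : RS n -> RS n := plin (fun x => RSact x.1 (bar_diff x.2)).

Definition RSaug n : RS n -> int := plin (fun x => (size x.2 == 0%N)%:R : int).

(* The composition of S(0), S(1), ... in degree 0, as it must be for
   [w] to act on the n-fold diagonal by x_0 ... x_(n-1) |-> x_(w 0) ... x_(w (n-1)):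
   the output [i] of [w], which carries the letter [w i], is split into [m]
   letters, themselves permuted by [v]. *)
Definition perm_comp n m (i : 'I_n.+1) (w : 'S_n.+1) (v : 'S_m) : 'S_(n + m) :=
  let a := w i : nat in
  let shift b := if (b < a)%N then b else (b + m).-1 in
  let pos (j : nat) : nat :=
    if (j < i)%N then shift (w (inord j))
    else if (j < i + m)%N then
      (a + (if insub (j - i)%N is Some j' then v j' : nat else 0))%N
    else shift (w (inord (j - m).+1)) in
  insubd (1%g : {perm 'I_(n + m)}) [ffun j : 'I_(n + m) => insubd j (pos j)].

(* homogeneous coordinates: g[g_1|...|g_m] <-> (g, g g_1, ..., g g_1 ... g_m) *)
Definition vertices n (x : 'S_n * seq 'S_n) : seq 'S_n :=
  x.1 :: scanl (fun a b => a * b)%g x.1 x.2.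
Definition of_vertices n (s : seq 'S_n) : RS n :=
  if s is w :: s' then bar w (pairmap (fun a b => a^-1 * b)%g w s') else 0.

(* Partial composition: the Eilenberg-Zilber map followed by [perm_comp] on
   vertices; the sum is over the (p, q)-shuffles, encoded as words on
   [true] (a step in the first factor) and [false]. *)
Definition bar_comp n m (i : 'I_n.+1) (x : 'S_n.+1 * seq 'S_n.+1)
    (y : 'S_m * seq 'S_m) : RS (n + m) :=
  let p := size x.2 in let q := size y.2 in
  \sum_(b : (p + q).-tuple bool | count_mem true b == p)
    of_vertices
      [seq perm_comp i (nth 1%g (vertices x) (count_mem true (take l b)))
                       (nth 1%g (vertices y) (count_mem false (take l b)))
      | l <- iota 0 (p + q).+1]
    *~ \prod_(j < p + q) \prod_(l < p + q | (j < l)%N)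
         sgn (~~ tnth b j && tnth b l).

Definition RScomp n m (i : 'I_n.+1) (u : RS n.+1) (v : RS m) : RS (n + m) :=
  plin (fun x => plin (fun y => bar_comp i x y) v) u.

(** * Coalgebras over the Barratt-Eccles operad *)

(* A complex with maps RS n (x) C -> C^(x)n, n >= 0, the one of arity 0 being
   an augmentation C -> C^(x)0 = Z *)
Record precoalg := PreCoalg {
  pc_cx :> chcx;
  act : forall n, RS n -> forall k, {additive pc_cx k -> tpow pc_cx n};
  act_cd0 : forall k (c : pc_cx k), act (bar 1%g [::] : RS 0) _ (cd pc_cx k c) = 0
}.

Arguments act C {n} u k : rename.

(* [act] is a morphism of operads S -> CoEnd(C) *)
Record is_coalg (C : precoalg) : Prop := IsCoalg {
  act_add : forall n (u v : RS n) k (c : C k),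
    act C (u + v) k c = act C u k c + act C v k c;
  act_deg : forall n (g : 'S_n) gs k (c : C k),
    thom (k + (size gs)%:Z) (act C (bar g gs) k c);
  act_perm : forall n (h : 'S_n) (u : RS n) k (c : C k),
    act C (RSact h u) k c = tperm_act h (act C u k c);
  act_cd : forall n (g : 'S_n) gs k (c : C k),
    tdiff (act C (bar g gs) k c)
    = act C (RSdiff (bar g gs)) k c
      + act C (bar g gs) _ (cd C k c) *~ sgn (size gs);
  act_unit : forall k (c : C k),
    act C (bar 1%g [::] : RS 1) k c = tens 1 [:: el c];
  (* the composition f o_i g of CoEnd(C) is
     (-1)^(|f||g|) (1 (x) ... (x) g (x) ... (x) 1) f *)
  act_comp : forall n m (i : 'I_n.+1) (g : 'S_n.+1) gs (h : 'S_m) hs k (c : C k),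
    act C (RScomp i (bar g gs) (bar h hs)) k c
    = tins i (size hs) (fun k' => act C (bar h hs) k') (n + m) (act C (bar g gs) k c)
      *~ sgn (size gs * size hs)
}.

Record comorph (C P : precoalg) := CoMorph {
  cmo :> chmap C P;
  cmo_act : forall n (u : RS n) k (c : C k),
    act P u k (cmo k c) = tmap (fun k' => cmo k') (act C u k c)
}.

Definition augm (C : precoalg) k : {additive C k -> tpow C 0} :=
  act C (bar 1%g [::] : RS 0) k.

(* [ceil C] is the kernel of the augmentation of C *)
Section Ceil.
Context (C : precoalg).

Definition ceil_cc (k : int) : zmodType := ker_of (augm C k).

Definition ceil_cd0 k (x : ceil_cc k) : ceil_cc (ipred k) :=
  ker_in (act_cd0 (val x)).

Lemma ceil_cd_is_zmod_morphism k : zmod_morphism (@ceil_cd0 k).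
Proof. by move=> x y; apply: val_inj; rewrite /= !raddfB. Qed.
HB.instance Definition _ k :=
  GRing.isZmodMorphism.Build _ _ (@ceil_cd0 k) (@ceil_cd_is_zmod_morphism k).

Lemma ceil_cdd k (x : ceil_cc k) : ceil_cd0 (ceil_cd0 x) = 0.
Proof. by apply: val_inj; rewrite /= cdd. Qed.

Definition ceil : chcx := @ChCx ceil_cc (fun k => @ceil_cd0 k) ceil_cdd.
End Ceil.

Section CeilMap.
Context (C P : precoalg) (a : comorph C P).

Lemma augm_cmo k (x : ceil C k) : augm P k (a k (val x)) = 0.
Proof. by rewrite /augm cmo_act (ker_out x) (@tmap0 C P 0 (fun k' => a k')). Qed.

Definition ceil_cm k (x : ceil C k) : ceil P k := ker_in (augm_cmo x).

Lemma ceil_cm_is_zmod_morphism k : zmod_morphism (@ceil_cm k).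
Proof. by move=> x y; apply: val_inj; rewrite /= !raddfB. Qed.
HB.instance Definition _ k :=
  GRing.isZmodMorphism.Build _ _ (@ceil_cm k) (@ceil_cm_is_zmod_morphism k).

Lemma ceil_cmd k (x : ceil C k) :
  ceil_cm (cd (ceil C) k x) = cd (ceil P) k (ceil_cm x).
Proof. by apply: val_inj; rewrite /= cmd. Qed.

Definition ceil_map : chmap (ceil C) (ceil P) :=
  @ChMap (ceil C) (ceil P) (fun k => @ceil_cm k) ceil_cmd.
End CeilMap.

(* Group-like elements satisfy a_n(c)(x) = eps_n(x) c^(x)n for n > 0;
   0 has to be excluded for pointed coalgebras to exist. *)
Definition grouplike (C : precoalg) (c : C 0) : Prop :=
  c <> 0 /\
  forall n, (0 < n)%N -> forall u : RS n,
    act C u 0 c = tens n (nseq n (el c)) *~ RSaug u.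

Definition subcoalg (C : precoalg) (S : forall k, C k -> Prop) : Prop :=
  exists (B : precoalg) (i : comorph B C),
    [/\ is_coalg B,
        forall k, injective (i k)
      & forall k (c : C k), S k c <-> exists b : B k, i k b = c].

Definition nonzero_sub (C : precoalg) (S : forall k, C k -> Prop) : Prop :=
  exists k (c : C k), S k c /\ c <> 0.

(* The zero sub-coalgebra is not among those whose intersections are required
   to contain 1. *)
Definition pointed_irreducible (C : precoalg) : Prop :=
  is_coalg C /\
  exists one : C 0,
    [/\ grouplike one,
        forall c : C 0, grouplike c -> c = one
      & forall S1 S2 : forall k, C k -> Prop,
          subcoalg S1 -> nonzero_sub S1 -> subcoalg S2 -> nonzero_sub S2 ->
          S1 0 one /\ S2 0 one].

(* [a] is the classifying map of [f] *)
Definition classifies (C P : precoalg) (E : chcx) (eps : chmap (ceil P) E)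
    (f : chmap (ceil C) E) (a : comorph C P) : Prop :=
  forall k (x : ceil C k), eps k (ceil_map a k x) = f k x.

Definition is_cofree (E : chcx) (P : precoalg) (eps : chmap (ceil P) E) : Prop :=
  pointed_irreducible P /\
  forall C : precoalg, pointed_irreducible C ->
  forall f : chmap (ceil C) E,
    exists a : comorph C P, classifies eps f a /\
      forall b : comorph C P, classifies eps f b ->
        forall k (c : C k), b k c = a k c.

(** * Simplicial sets and simplicial abelian groups *)

(* morphisms [m] -> [n] of the simplex category *)
Definition mono m n :=
  {th : {ffun 'I_m.+1 -> 'I_n.+1} |
    [forall i : 'I_m.+1, forall j : 'I_m.+1, (i <= j)%N ==> (th i <= th j)%N]}.

Lemma monoP m n (th : mono m n) (i j : 'I_m.+1) :
  (i <= j)%N -> (val th i <= val th j)%N.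
Proof. by case: th => th /= /forallP /(_ i) /forallP /(_ j) /implyP. Qed.

Definition mk_mono m n (f : 'I_m.+1 -> 'I_n.+1)
  (fP : forall i j : 'I_m.+1, (i <= j)%N -> (f i <= f j)%N) : mono m n.
Proof.
exists [ffun i => f i].
by apply/forallP => i; apply/forallP => j; apply/implyP => /fP; rewrite !ffunE.
Defined.

Lemma mono_ext m n (f g : mono m n) : (forall i, val f i = val g i) -> f = g.
Proof. by move=> fg; apply/val_inj/ffunP. Qed.

Definition mid n : mono n n := @mk_mono n n id (fun _ _ h => h).

Definition mcomp m n p (g : mono n p) (f : mono m n) : mono m p :=
  @mk_mono m p (fun i => val g (val f i)) (fun i j h => monoP g (monoP f h)).

Definition mconst n : mono n 0 :=
  @mk_mono n 0 (fun=> ord0) (fun _ _ _ => leqnn _).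

Lemma lift_mono n (i : 'I_n.+2) (j k : 'I_n.+1) :
  (j <= k)%N -> (fintype.lift i j <= fintype.lift i k)%N.
Proof. by rewrite /= leq_bump2. Qed.

(* the i-th coface, skipping [i] *)
Definition coface n (i : 'I_n.+2) : mono n n.+1 := mk_mono (@lift_mono n i).

Lemma coface_coface m (i j : nat) : (j < i <= m.+2)%N ->
  mcomp (@coface m.+1 (inord i)) (@coface m (inord j))
  = mcomp (@coface m.+1 (inord j)) (@coface m (inord i.-1)).
Proof.
move=> ij; apply: mono_ext => k; rewrite /= !ffunE; apply: val_inj => /=.
by rewrite !inordK /bump; lia.
Qed.

Record psset := PSSet {
  sx :> nat -> choiceType;
  sres : forall m n, mono m n -> sx n -> sx m;
  spt : sx 0;
  sres_id : forall n x, sres (mid n) x = x;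
  sres_comp : forall m n p (g : mono n p) (f : mono m n) x,
    sres (mcomp g f) x = sres f (sres g x)
}.

Definition spts (X : psset) n : X n := sres (mconst n) (spt X).

Lemma sres_spts (X : psset) m n (f : mono m n) : sres f (spts X n) = spts X m.
Proof.
rewrite /spts -sres_comp; congr sres.
by apply: mono_ext => i; rewrite !ffunE.
Qed.

Record sab := SAb {
  ab :> nat -> zmodType;
  ares : forall m n, mono m n -> {additive ab n -> ab m};
  ares_id : forall n x, ares (mid n) x = x;
  ares_comp : forall m n p (g : mono n p) (f : mono m n) x,
    ares (mcomp g f) x = ares f (ares g x)
}.

(* the underlying simplicial set, pointed by 0 *)
Definition upsset (A : sab) : psset :=
  @PSSet (fun n => A n) (fun m n f => ares A f) 0 (@ares_id A) (@ares_comp A).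

Section Moore.
Context (A : sab).

Definition moore_d0 m (x : A m.+1) : A m :=
  \sum_(i < m.+2) ares A (coface i) x *~ sgn i.

Lemma moore_d_is_zmod_morphism m : zmod_morphism (@moore_d0 m).
Proof.
move=> x y; rewrite -sumrB; apply: eq_bigr => i _.
by rewrite raddfB mulrzBl.
Qed.
HB.instance Definition _ m :=
  GRing.isZmodMorphism.Build _ _ (@moore_d0 m) (@moore_d_is_zmod_morphism m).

Lemma moore_dd m (x : A m.+2) : moore_d0 (moore_d0 x) = 0.
Proof.
rewrite /moore_d0.
under eq_bigr => j _ do rewrite raddf_sum mulrz_suml.
rewrite exchange_big /= -[RHS](@alternating_sum0 _ m (fun i j =>
  ares A (mcomp (@coface m.+1 (inord i)) (@coface m (inord j))) x)); last first.
  by move=> i j ij; rewrite coface_coface.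
apply: eq_bigr => i _; apply: eq_bigr => j _.
by rewrite raddfMz -mulrzA ares_comp !inord_val /sgn exprD mulrC.
Qed.

(* the unnormalized Moore complex {A} *)
Definition moore : chcx :=
  natcx (d := fun m => @moore_d0 m) moore_dd.
End Moore.

(** * The Dold-Kan simplicial abelian group *)

(* An n-simplex of [dold_kan D] is a chain map from the normalized chains of
   the n-simplex to D: a family indexed by the simplices [p] -> [n], vanishing
   on the degenerate ones and compatible with the differentials. *)
Section DoldKan.
Context (D : chcx).

Definition dk_chain n (x : forall p, mono p n -> D (Posz p)) : Prop :=
  (forall p (s : mono p n), ~~ injectiveb (val s) -> x p s = 0) /\
  (forall p (s : mono p.+1 n),
     cd D (Posz p.+1) (x p.+1 s)
     = \sum_(i < p.+2) x p (mcomp s (coface i)) *~ sgn i) /\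
  (forall s : mono 0 n, cd D (Posz 0) (x 0 s) = 0).

Record dk n := DK {
  dk_val : forall p, mono p n -> D (Posz p);
  dk_valP : dk_chain dk_val
}.

Lemma dk_ext n (x y : dk n) : (forall p s, @dk_val n x p s = dk_val y s) -> x = y.
Proof.
case: x y => [x xP] [y yP] /= xy.
have E : x = y by apply: functional_extensionality_dep => p; apply: funext.
by rewrite E in xP *; congr DK; apply: Prop_irrelevance.
Qed.

HB.instance Definition _ n := gen_eqMixin (dk n).
HB.instance Definition _ n := gen_choiceMixin (dk n).

Section Ops.
Context (n : nat).

Lemma dk0P : dk_chain (fun p (_ : mono p n) => 0).
Proof.
split=> //; split=> [p s|s]; last exact: raddf0.
by rewrite raddf0 big1 // => i _; apply: mul0rz.
Qed.
Definition dk0 : dk n := DK dk0P.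

Lemma dkNP (x : dk n) : dk_chain (fun p (s : mono p n) => - dk_val x s).
Proof.
case: x => x [x0 [xd xd0]] /=; split=> [p s /x0 ->|]; first by rewrite oppr0.
split=> [p s|s]; last by rewrite raddfN xd0 oppr0.
by rewrite raddfN xd -sumrN; apply: eq_bigr => i _; rewrite mulNrz.
Qed.
Definition dkN (x : dk n) : dk n := DK (dkNP x).

Lemma dkDP (x y : dk n) :
  dk_chain (fun p (s : mono p n) => dk_val x s + dk_val y s).
Proof.
case: x y => [x [x0 [xd xd0]]] [y [y0 [yd yd0]]] /=.
split=> [p s si|]; first by rewrite x0 // y0 // addr0.
split=> [p s|s]; last by rewrite raddfD xd0 yd0 addr0.
by rewrite raddfD xd yd -big_split; apply: eq_bigr => i _; rewrite mulrzDl.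
Qed.
Definition dkD (x y : dk n) : dk n := DK (dkDP x y).

Lemma dkA : associative dkD.
Proof. by move=> x y z; apply: dk_ext => p s /=; rewrite addrA. Qed.
Lemma dkC : commutative dkD.
Proof. by move=> x y; apply: dk_ext => p s /=; rewrite addrC. Qed.
Lemma dk0D : left_id dk0 dkD.
Proof. by move=> x; apply: dk_ext => p s /=; rewrite add0r. Qed.
Lemma dkND : left_inverse dk0 dkN dkD.
Proof. by move=> x; apply: dk_ext => p s /=; rewrite addNr. Qed.

HB.instance Definition _ := GRing.isZmodule.Build (dk n) dkA dkC dk0D dkND.
End Ops.

Lemma dk_resP m n (f : mono m n) (x : dk n) :
  dk_chain (fun p (s : mono p m) => dk_val x (mcomp f s)).
Proof.
case: x => x [x0 [xd xd0]] /=; split=> [p s si|].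
  apply: x0; apply: contra si => /injectiveP fs; apply/injectiveP => i j ij.
  by apply: fs; rewrite /= !ffunE ij.
split=> [p s|s]; last exact: xd0.
rewrite xd; apply: eq_bigr => i _; congr (x p _ *~ _).
by apply: mono_ext => j; rewrite /= !ffunE.
Qed.
Definition dk_res m n (f : mono m n) (x : dk n) : dk m := DK (dk_resP f x).

Lemma dk_res_is_zmod_morphism m n (f : mono m n) : zmod_morphism (dk_res f).
Proof. by move=> x y; apply: dk_ext. Qed.
HB.instance Definition _ m n (f : mono m n) :=
  GRing.isZmodMorphism.Build _ _ (dk_res f) (dk_res_is_zmod_morphism f).

Lemma dk_res_id n (x : dk n) : dk_res (mid n) x = x.
Proof.
apply: dk_ext => p s /=; congr (dk_val x _).
by apply: mono_ext => i; rewrite /= !ffunE.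
Qed.

Lemma dk_res_comp m n p (g : mono n p) (f : mono m n) (x : dk p) :
  dk_res (mcomp g f) x = dk_res f (dk_res g x).
Proof.
apply: dk_ext => q s /=; congr (dk_val x _).
by apply: mono_ext => i; rewrite /= !ffunE.
Qed.

Definition dold_kan : sab :=
  @SAb (fun n => dk n) (fun m n f => dk_res f) dk_res_id dk_res_comp.
End DoldKan.

(** * The coalgebra of chains of a simplicial set *)

(* Faces of a standard simplex are written as increasing lists of vertices
   [:: i_0; ...; i_t]; the n-th tensor power of its normalized chains is
   [fg (seq (seq nat))], restricted to words of length n.  All formulas below
   depend on the vertices only through their order, and so are natural for face
   inclusions. *)

Definition face_bd (F : seq nat) : fg (seq nat) :=
  if (size F <= 1)%N then 0
  else \sum_(i < size F) fgen (take i F ++ drop i.+1 F) *~ sgn i.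

(* The two conventions for the order of the factors of the Alexander-Whitney
   coproduct, sum_j [i_0, ..., i_j] (x) [i_j, ..., i_t] or its composite with
   the (signed) exchange of factors.  With the contraction [contr] below, whose
   cone point is the last vertex, the recursion [smith] produces maps that are
   compatible with the operad compositions for [BackFront]. For [FrontBack] they
   are not: with tau the transposition, the composite [tau] o_0 [] of a 1-chain
   and a 0-chain of RS_2 acts on the 1-simplex differently from the composite
   of the actions. *)
Variant aw_order := FrontBack | BackFront.

Fixpoint alexander_whitney (o : aw_order) (n : nat) (F : seq nat)
  : fg (seq (seq nat)) :=
  if n is n'.+1 then
    \sum_(j < size F)
      match o with
      | FrontBack =>
          lin (fun t => fgen (take j.+1 F :: t))
              (alexander_whitney o n' (drop j F))
      | BackFront =>
          lin (fun t => fgen (drop j F :: t))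
              (alexander_whitney o n' (take j.+1 F))
          *~ sgn (j * ((size F).-1 - j))
      end
  else if size F == 1%N then fgen [::] else 0.

Definition cone (v : nat) (F : seq nat) : fg (seq nat) :=
  if last 0%N F == v then 0 else fgen (rcons F v) *~ sgn (size F).

(* sum_r (i eps)^(x)r (x) cone (x) 1 (x) ... (x) 1 *)
Fixpoint contr (v : nat) (t : seq (seq nat)) : fg (seq (seq nat)) :=
  if t is F :: t' then
    lin (fun G => fgen (G :: t')) (cone v F)
    + (if size F == 1%N then lin (fun u => fgen ([:: v] :: u)) (contr v t') else 0)
  else 0.

Definition face_perm n (s : 'S_n) (t : seq (seq nat)) : fg (seq (seq nat)) :=
  fgen (permute s [::] t) *~ koszul s (fun j => (size (nth [::] t j)).-1).

(* f([g_1|...|g_m] (x) F); [N] bounds the depth of the recursion *)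
Fixpoint smith_rec (o : aw_order) n (N : nat) (gs : seq 'S_n) (F : seq nat)
  : fg (seq (seq nat)) :=
  if N is N'.+1 then
    if gs is [::] then alexander_whitney o n F
    else
      lin (contr (last 0%N F))
        (plin (fun x => lin (face_perm x.1) (smith_rec o N' x.2 F)) (bar_diff gs)
         + lin (smith_rec o N' gs) (face_bd F) *~ sgn (size gs))
  else 0.

Definition smith (o : aw_order) n (gs : seq 'S_n) (F : seq nat) :=
  smith_rec o (size gs + size F).+1 gs F.

Section Chains.
Context (o : aw_order) (X : psset).

Definition chain_cc m : zmodType :=
  pfree (fun x : X m => (0 < m)%N && (x == spts X m)).

(* the generator [x]; zero on the degenerate simplices of the basepoint *)
Definition simp m (x : X m) : chain_cc m := pgen _ x.

Definition chain_d m : chain_cc m.+1 -> chain_cc m :=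
  plin (fun x => \sum_(i < m.+2) simp (sres (coface i) x) *~ sgn i).
HB.instance Definition _ m := GRing.Additive.copy (@chain_d m)
  (plin (fun x : X m.+1 => \sum_(i < m.+2) simp (sres (coface i) x) *~ sgn i)).

Lemma chain_d_simp m (x : X m.+1) :
  chain_d (simp x) = \sum_(i < m.+2) simp (sres (coface i) x) *~ sgn i.
Proof.
apply: plin_genE => /andP[_ /eqP ->].
under eq_bigr => i _ do rewrite sres_spts.
case: m x => [|m] _; first by rewrite !big_ord_recl big_ord0 addr0 /sgn mulr1z mulrN1z subrr.
rewrite big1 // => i _; rewrite /simp pgen0 ?eqxx //; exact: mul0rz.
Qed.

Lemma chain_dd m (u : chain_cc m.+2) : chain_d (chain_d u) = 0.
Proof.
apply: (@plin_ext _ _ _ (@chain_d m \o @chain_d m.+1) \0) => x /=.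
rewrite -/(simp x) chain_d_simp raddf_sum.
rewrite -[RHS](@alternating_sum0 _ m (fun i j =>
  simp (sres (mcomp (@coface m.+1 (inord i)) (@coface m (inord j))) x))); last first.
  by move=> i j ij; rewrite coface_coface.
apply: eq_bigr => i _; rewrite [LHS](raddfMz (@chain_d m)) /= chain_d_simp mulrz_suml.
apply: eq_bigr => j _.
by rewrite -mulrzA sres_comp !inord_val /sgn exprD mulrC.
Qed.

Definition chain_cx : chcx := natcx (d := fun m => @chain_d m) chain_dd.

(* the face of [x] with vertices [F], as an element of the chains *)
Definition face_incl m (F : seq nat) : mono (size F).-1 m :=
  insubd (@mk_mono _ _ (fun=> ord0) (fun _ _ _ => leqnn _))
         [ffun j : 'I_(size F).-1.+1 => inord (nth 0%N F j) : 'I_m.+1].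
Definition face_el m (x : X m) (F : seq nat) : elt chain_cx :=
  @el chain_cx (Posz (size F).-1) (simp (sres (face_incl m F) x)).

Definition smith_act_gen n m (x : X m) : RS n -> tpow chain_cx n :=
  plin (fun e : 'S_n * seq 'S_n =>
    lin (fun t => tens n [seq face_el x F | F <- t])
        (lin (face_perm e.1) (smith o e.2 (iota 0 m.+1)))).

Definition smith_act n (u : RS n) (k : int) : {additive chain_cx k -> tpow chain_cx n} :=
  match k return {additive chain_cx k -> tpow chain_cx n} with
  | Posz m => plin (fun x : X m => smith_act_gen x u)
  | Negz _ => \0
  end.

Lemma smith_act_gen0 m (x : X m) :
  smith_act_gen x (bar 1%g [::] : RS 0) = if m == 0%N then tens 0 [::] else 0.
Proof.
rewrite /smith_act_gen plin_gen /= /smith /= size_iota eqSS.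
case: eqP => _; last by rewrite !raddf0.
rewrite lin_gen /face_perm /permute /koszul big_ord0 mulr1z lin_gen.
by rewrite enum_ord0.
Qed.

Lemma smith_act_cd0 k (c : chain_cx k) :
  smith_act (bar 1%g [::] : RS 0) _ (cd chain_cx k c) = 0.
Proof.
case: k c => [[|m]|m] c //.
pose g : X m -> tpow chain_cx 0 := fun x => smith_act_gen x (bar 1%g [::]).
apply: (@plin_ext _ _ _ (plin g \o @chain_d m) \0 _ c) => x /=.
rewrite -/(simp x) chain_d_simp raddf_sum.
have gE (y : X m) : plin g (simp y) = if m == 0%N then tens 0 [::] else 0.
  rewrite /g plin_genE smith_act_gen0 //.
  by move=> /andP[m0 _]; rewrite gtn_eqF.
rewrite (eq_bigr (fun i : 'I_m.+2 =>
  (if m == 0%N then tens 0 [::] else 0) *~ sgn i)); last first.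
  by move=> i _; rewrite [LHS](raddfMz (plin g)); congr (_ *~ _); apply: gE.
case: eqP => m0; last by rewrite big1 // => i _; exact: mul0rz.
by subst m; rewrite !big_ord_recl big_ord0 addr0 /sgn mulr1z mulrN1z subrr.
Qed.

Definition smith_coalg : precoalg := PreCoalg smith_act_cd0.
End Chains.

(** * The chain map c *)

Section Collapse.
Context (o : aw_order) (A : sab).

Definition collapse_cm (k : int)
  : {additive chain_cx (upsset A) k -> moore A k} :=
  match k return {additive chain_cx (upsset A) k -> moore A k} with
  | Posz m => plin (fun z : A m => z)
  | Negz _ => \0
  end.

Lemma collapse_simp m (z : A m) :
  collapse_cm (Posz m) (simp (z : upsset A m)) = z.
Proof.
apply: plin_genE => /andP[_ /eqP ->].
exact: (raddf0 (ares A (mconst m))).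
Qed.

Lemma collapse_cmd k (x : chain_cx (upsset A) k) :
  collapse_cm (ipred k) (cd _ k x) = cd (moore A) k (collapse_cm k x).
Proof.
case: k x => [[|m]|m] x //.
apply: (@plin_ext _ _ _ (collapse_cm (Posz m) \o cd _ (Posz m.+1))
  (cd (moore A) (Posz m.+1) \o collapse_cm (Posz m.+1))) => z.
change (collapse_cm (Posz m) (chain_d (simp (z : upsset A m.+1)))
  = moore_d0 (collapse_cm (Posz m.+1) (simp (z : upsset A m.+1)))).
rewrite collapse_simp chain_d_simp raddf_sum; apply: eq_bigr => i _.
by rewrite raddfMz collapse_simp.
Qed.

Definition collapse0 k (x : ceil (smith_coalg o (upsset A)) k) : moore A k :=
  collapse_cm k (val x).

Lemma collapse0_is_zmod_morphism k : zmod_morphism (@collapse0 k).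
Proof. by move=> x y; rewrite /collapse0 !raddfB. Qed.
HB.instance Definition _ k :=
  GRing.isZmodMorphism.Build _ _ (@collapse0 k) (@collapse0_is_zmod_morphism k).

Lemma collapse0_cd k (x : ceil (smith_coalg o (upsset A)) k) :
  collapse0 (cd _ k x) = cd (moore A) k (collapse0 x).
Proof. by rewrite /collapse0 -collapse_cmd. Qed.

Definition collapse : chmap (ceil (smith_coalg o (upsset A))) (moore A) :=
  @ChMap (ceil (smith_coalg o (upsset A))) (moore A)
    (fun k => @collapse0 k) collapse0_cd.
End Collapse.

(* Main.v *)
From HB Require Import structures.
Require Import Defs.
From mathcomp Require Import all_boot all_order all_algebra fingroup perm.
From mathcomp Require Import boolp zify ring.
From mathcomp.multinomials Require Import freeg.

(* Let e_m = [tau|...|tau] be the generator of degree m of RS_2. On an m-simplex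
   f(e_m (x) Delta) is a nonzero multiple of Delta (x) Delta: only one term
   survives the contraction, the one with first factor the face opposite to the
   last vertex v, because words in the image of the contraction have a first
   factor ending in v.
   Hence, for m > 0, the image p = gamma [z] of an m-simplex z satisfies
   e_m p = s p (x) p, with s independent of z, and for any phi : P_m -> Z the
   operator (phi (x) 1) e_m acts on p as the scalar s phi(p). As eps p = z, the
   images of distinct simplices are separated by such phi (Gamma D embeds in a
   product of free abelian groups), so Lagrange interpolation in these operators
   kills all the coefficients of a relation between them. In degree 0 there is
   only the basepoint, which the augmentation detects. *)

Set Implicit Arguments.
Unset Strict Implicit.
Unset Printing Implicit Defensive.

Import GRing.Theory Num.Theory.
Local Open Scope ring_scope.

(** * Supports in free abelian groups *)

Lemma coeff_fgen (T : choiceType) (x y : T) : coeff y (fgen x) = (x == y)%:R.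
Proof. by rewrite /fgen coeffU mul1r. Qed.

Definition supp (T : choiceType) (P : pred T) (u : fg T) : Prop :=
  forall t, ~~ P t -> coeff t u = 0.

Section Support.
Context (T : choiceType).
Implicit Types (P : pred T) (u v : fg T).

Lemma supp0 P : supp P 0.
Proof. by move=> t _; rewrite raddf0. Qed.

Lemma suppD P u v : supp P u -> supp P v -> supp P (u + v).
Proof. by move=> pu pv t nt; rewrite raddfD /= pu // pv // addr0. Qed.

Lemma suppMz P u m : supp P u -> supp P (u *~ m).
Proof. by move=> pu t nt; rewrite raddfMz /= pu // mul0rz. Qed.

Lemma supp_sum P (I : Type) (r : seq I) (Q : pred I) (F : I -> fg T) :
  (forall i, Q i -> supp P (F i)) -> supp P (\sum_(i <- r | Q i) F i).
Proof. by move=> pF; apply: big_ind => //; [exact: supp0|exact: suppD]. Qed.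

Lemma supp_gen P x : P x -> supp P (fgen x).
Proof.
by move=> px t nt; rewrite coeff_fgen; case: eqP nt => // <-; rewrite px.
Qed.

Lemma supp_dom P u : supp P u -> {in dom u, forall t, P t}.
Proof.
by move=> pu t; rewrite mem_dom; case: (boolP (P t)) => // /pu ->; rewrite eqxx.
Qed.

Lemma sub_supp P Q u : {subset P <= Q} -> supp P u -> supp Q u.
Proof. by move=> PQ pu t nt; apply: pu; apply: contra nt => /PQ. Qed.

End Support.

Section SupportLin.
Context (T : choiceType).
Implicit Types (P : pred T) (u : fg T).

Lemma supp_lin (S : choiceType) P (Q : pred S) (f : T -> fg S) u :
  supp P u -> (forall t, P t -> supp Q (f t)) -> supp Q (lin f u).
Proof.
move=> /supp_dom pu fQ; rewrite /lin big_seq_cond; apply: supp_sum => x.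
by rewrite andbT => /pu /fQ; exact: suppMz.
Qed.

Lemma supp_ext (V : zmodType) P (g h : {additive fg T -> V}) u :
  supp P u -> (forall x, P x -> g (fgen x) = h (fgen x)) -> g u = h u.
Proof.
move=> /supp_dom pu gh; rewrite [u]fg_sum !raddf_sum.
apply: eq_big_seq => x /pu px.
by rewrite !raddfMz gh.
Qed.

(** Presents a coefficient as a linear extension, so that identities between coefficients can be
    checked on generators with [supp_ext]. *)
Lemma lin_delta (V : zmodType) x (y : V) u :
  lin (fun t => if t == x then y else 0) u = y *~ coeff x u.
Proof.
have -> : coeff x u = \sum_(t <- dom u) (t == x)%:R * coeff t u.
  rewrite {1}[u]fg_sum raddf_sum; apply: eq_bigr => t _.
  by rewrite raddfMz /= coeff_fgen -mulrzr intz.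
rewrite mulrz_sumr; apply: eq_bigr => t _.
by case: eqP => _; rewrite ?mul0rz ?mul0r ?mulr0z // mul1r.
Qed.
End SupportLin.

(** * The action of [tau|...|tau] on a simplex *)

Definition tau : 'S_2 := tperm ord0 ord_max.

Lemma tau_neq1 : tau != 1%g.
Proof.
apply/eqP => /permP /(_ ord0).
by rewrite tpermL perm1.
Qed.

(** Ensures that [tau|...|tau] survives the normalization, which kills the symbols with an entry
    1. *)
Lemma tau_free m : 1%g \notin nseq m tau.
Proof. by rewrite mem_nseq negb_and eq_sym tau_neq1 orbT. Qed.

Lemma enum_I2 : enum 'I_2 = [:: ord0; ord_max].
Proof.
by apply: (inj_map val_inj); rewrite val_enum_ord.
Qed.

Lemma koszul2 (s : 'S_2) deg :
  koszul s deg
  = if (s ord_max < s ord0)%N then sgn (deg (s ord0) * deg (s ord_max)) else 1.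
Proof.
have l0 : fintype.lift ord0 ord0 = ord_max :> 'I_2 by apply: val_inj.
rewrite /koszul big_ord_recl big_ord_recl big_ord0 mulr1 l0.
rewrite !(big_mkcond (fun j => _ && _)) /= !big_ord_recl !big_ord0 /= l0 /=.
by rewrite !mulr1 mul1r.
Qed.

Lemma face_perm1 A B : face_perm (1%g : 'S_2) [:: A; B] = fgen [:: A; B].
Proof. by rewrite /face_perm /permute enum_I2 koszul2 /= !perm1 /= mulr1z. Qed.

Lemma face_perm_tau A B :
  face_perm tau [:: A; B]
  = fgen [:: B; A] *~ sgn ((size B).-1 * (size A).-1).
Proof. by rewrite /face_perm /permute enum_I2 koszul2 /= tpermL tpermR. Qed.

(** Every inner term of the bar differential has an entry tau * tau = 1 and is zero by
    normalization; the two outer terms remain. *)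
Lemma bar_diff_tau m :
  bar_diff (nseq m.+1 tau)
  = bar tau (nseq m tau) + bar 1%g (nseq m tau) *~ sgn m.+1.
Proof.
rewrite /bar_diff /= size_nseq; congr (_ + _ *~ _); last first.
  by congr bar; rewrite -[tau :: _]/(nseq m.+1 tau) take_nseq.
rewrite big_nat_cond big1 ?addr0 // => i /andP[/andP[i0 im] _].
rewrite /bar pgen0 ?mul0rz //= mem_cat inE; apply/orP; right; apply/orP; left.
rewrite -[tau :: nseq m tau]/(nseq m.+1 tau) !nth_nseq.
have -> : (i.-1 < m.+1)%N by lia.
by rewrite im /tau tperm2.
Qed.

(* On a face [F] with large enough fuel [N], Steenrod's cup-m coproduct. *)
Definition cup_rec (o : aw_order) (N m : nat) (F : seq nat) : fg (seq (seq nat)) :=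
  smith_rec o N (nseq m tau) F.

(** The identity permutation is kept as an operator because it fixes only words of length two;
    [lin_face_perm1] removes it once the support is known. *)
Lemma cup_recS o N m F :
  cup_rec o N.+1 m.+1 F =
  lin (contr (last 0%N F))
    (lin (face_perm tau) (cup_rec o N m F)
     + lin (face_perm (1%g : 'S_2)) (cup_rec o N m F) *~ sgn m.+1
     + lin (cup_rec o N m.+1) (face_bd F) *~ sgn m.+1).
Proof.
rewrite -[LHS]/(lin (contr (last 0%N F))
  (plin (fun x => lin (face_perm x.1) (smith_rec o N x.2 F))
     (bar_diff (nseq m.+1 tau))
   + lin (cup_rec o N m.+1) (face_bd F) *~ sgn (size (nseq m.+1 tau)))).
congr (lin _ (_ + _)); last by rewrite size_nseq.
rewrite bar_diff_tau raddfD raddfMz /= /bar.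
by rewrite !plin_gen /= (negbTE (tau_free m)).
Qed.

(** * The Alexander-Whitney coproduct and the contraction in arity two *)

Lemma alexander_whitney1 o (F : seq nat) :
  F != [::] -> alexander_whitney o 1 F = fgen [:: F].
Proof.
case/lastP: F => // F v _; rewrite /= size_rcons.
(* Arity 0 accepts only a single vertex, so one term survives: the last j for [FrontBack], and j = 0
   for [BackFront]. *)
case: o.
  rewrite big_ord_recr /= big1 ?add0r => [|i _].
    rewrite size_drop size_rcons subSnn eqxx lin_gen.
    by rewrite take_oversize // size_rcons.
  rewrite size_drop size_rcons ifF ?raddf0 //.
 by have := ltn_ord i; lia.
rewrite big_ord_recl /= big1 ?addr0 => [|i _].
  by rewrite size_takel ?size_rcons //= lin_gen drop0 mul0n mulr1z.
rewrite size_takel ?size_rcons //= ?raddf0 ?mul0rz // /bump.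
by have := ltn_ord i; lia.
Qed.

Lemma alexander_whitneyS o n (F : seq nat) :
  alexander_whitney o n.+1 F = \sum_(j < size F)
    match o with
    | FrontBack =>
        lin (fun t => fgen (take j.+1 F :: t)) (alexander_whitney o n (drop j F))
    | BackFront =>
        lin (fun t => fgen (drop j F :: t)) (alexander_whitney o n (take j.+1 F))
        *~ sgn (j * ((size F).-1 - j))
    end.
Proof. by []. Qed.

Lemma alexander_whitney2 o (F : seq nat) :
  alexander_whitney o 2 F = \sum_(j < size F)
    match o with
    | FrontBack => fgen [:: take j.+1 F; drop j F]
    | BackFront => fgen [:: drop j F; take j.+1 F]
                   *~ sgn (j * ((size F).-1 - j))
    end.
Proof.
rewrite alexander_whitneyS; apply: eq_bigr => j _.
have dj : drop j F != [::].
  by rewrite -size_eq0 size_drop subn_eq0 -ltnNge.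
have tj : take j.+1 F != [::].
  by case: F j {dj} => [[]|].
by case: o; rewrite alexander_whitney1 // lin_gen.
Qed.

Lemma contr2 v A B :
  contr v [:: A; B]
  = (if last 0%N A == v then 0 else fgen [:: rcons A v; B] *~ sgn (size A))
    + (if (size A == 1%N) && (last 0%N B != v)
       then fgen [:: [:: v]; rcons B v] *~ sgn (size B) else 0).
Proof.
rewrite /contr /cone; congr (_ + _).
  by case: eqP => _; rewrite ?raddf0 ?raddfMz /= ?lin_gen.
case: (size A == 1%N) => //=.
have -> : (if size B == 1%N then lin (fun u => fgen ([:: v] :: u)) 0 else 0) = 0
    :> fg (seq (seq nat)).
  by case: ifP => // _; rewrite raddf0.
rewrite addr0; case: eqP => _ /=; first by rewrite !raddf0.
by rewrite !raddfMz /= !lin_gen.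
Qed.

(** * Counting the dimensions of the factors *)

Lemma subseq_rcons_last (T : eqType) (x0 v : T) (A F : seq T) :
  A != [::] -> last x0 A != v -> subseq A (rcons F v) -> subseq A F.
Proof.
case/lastP: A => // A a _; rewrite last_rcons => av.
(* Reversal brings the last letters to the front, where [subseq] computes. *)
by rewrite -subseq_rev !rev_rcons /= (negbTE av) -rev_rcons subseq_rev.
Qed.

(* The pairs of faces of [F] of total dimension [m + dim F]; the size of a face
   is its dimension plus one. *)
Definition face_pair (F : seq nat) (m : nat) : pred (seq (seq nat)) := fun t =>
  if t is [:: A; B] then
    [&& subseq A F, subseq B F, A != [::], B != [::]
      & size A + size B == (m + size F).+1]%N
  else false.

Section DropNth.
Context (T : eqType) (F : seq T) (i : nat).

Lemma size_drop_nth :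
  (i < size F)%N -> size F = (size (take i F ++ drop i.+1 F)).+1.
Proof.
have nE n : (i < n)%N -> n = (i + (n - i.+1)).+1 by lia.
by move=> lti; rewrite size_cat size_drop size_takel; [exact: nE|exact: ltnW].
Qed.

Lemma subseq_drop_nth : subseq (take i F ++ drop i.+1 F) F.
Proof.
rewrite -[X in subseq _ X](cat_take_drop i) cat_subseq //.
by rewrite -[i.+1]add1n -drop_drop drop_subseq.
Qed.
End DropNth.

Lemma face_bd_supp (F : seq nat) :
  supp (fun G => [&& subseq G F, G != [::] & size F == (size G).+1])
    (face_bd F).
Proof.
rewrite /face_bd; case: ifP => [_|F2]; first exact: supp0.
apply: supp_sum => i _; apply/suppMz/supp_gen.
have sG := size_drop_nth (ltn_ord i).
rewrite subseq_drop_nth -sG eqxx andbT -size_eq0.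
by apply: contraFN F2 => /eqP G0; rewrite sG G0.
Qed.

(** The contraction appends the last vertex of [F] to a factor not ending in it, possibly after
    moving a vertex there, so both factors remain faces of [F] and the total dimension rises by
    one. *)
Lemma contr_supp F m t :
  F != [::] -> face_pair F m t -> supp (face_pair F m.+1) (contr (last 0%N F) t).
Proof.
case/lastP: F => // F v _; rewrite last_rcons.
case: t => [|A [|B [|//]]] // ABm; rewrite contr2.
case/and5P: ABm => AF BF A0 B0 /eqP sAB; apply: suppD.
  case: ifPn => [_|Av]; first exact: supp0.
  apply/suppMz/supp_gen; rewrite /= BF B0 size_rcons addSn sAB eqxx andbT.
  rewrite -size_eq0 size_rcons -(cats1 A) -(cats1 F).
  by rewrite (cat_subseq (subseq_rcons_last A0 Av AF)).
case: ifPn => [/andP[/eqP A1 Bv]|_]; last exact: supp0.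
apply/suppMz/supp_gen; apply/and5P; split => //.
- by rewrite -cats1 (cat_subseq (sub0seq F)).
- by rewrite -(cats1 B) -(cats1 F) (cat_subseq (subseq_rcons_last B0 Bv BF)).
- by case: (B).
- by rewrite size_rcons addnS -[size [:: v]]A1 sAB.
Qed.

Lemma face_pairC F m A B : face_pair F m [:: A; B] = face_pair F m [:: B; A].
Proof.
rewrite /= addnC !andbA; congr (_ && _); rewrite -!andbA andbCA.
by do 2!congr andb; rewrite andbC.
Qed.

Lemma face_perm_tau_supp F m t :
  face_pair F m t -> supp (face_pair F m) (face_perm tau t).
Proof.
case: t => [|A [|B [|//]]] // ABm.
by rewrite face_perm_tau; apply/suppMz/supp_gen; rewrite face_pairC.
Qed.

Lemma lin_face_perm1 F m u :
  supp (face_pair F m) u -> lin (face_perm (1%g : 'S_2)) u = u.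
Proof.
move=> um; apply: (supp_ext (h := idfun) um) => -[|A [|B [|//]]] // _.
by rewrite /= lin_gen face_perm1.
Qed.

(** A boundary face has one dimension less than [F], which offsets the extra one in [m.+1]. *)
Lemma lin_face_bd_supp (f : seq nat -> fg (seq (seq nat))) m F :
  (forall G, G != [::] -> supp (face_pair G m.+1) (f G)) ->
  supp (face_pair F m) (lin f (face_bd F)).
Proof.
move=> fm; apply: (supp_lin (face_bd_supp (F := F))) => G /and3P[GF G0 /eqP sG].
apply: sub_supp (fm G G0) => -[|A [|B [|//]]] //=.
rewrite !unfold_in /= => /and5P[AG BG -> -> /eqP ->].
by rewrite (subseq_trans AG GF) (subseq_trans BG GF) sG addSnnS eqxx.
Qed.

(** Induction on the fuel: the zero returned when it runs out has any support, so the dimension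
    count holds for every [N]. *)
Lemma cup_supp o N m F : F != [::] -> supp (face_pair F m) (cup_rec o N m F).
Proof.
elim: N m F => [|N IHN] m F F0; first exact: supp0.
case: m => [|m].
  rewrite /cup_rec -[smith_rec _ _ _ _]/(alexander_whitney o 2 F).
  rewrite alexander_whitney2; apply: supp_sum => j _.
  have lj := ltn_ord j.
  have dj : drop j F != [::] by rewrite -size_eq0 size_drop subn_eq0 -ltnNge.
  have tj : take j.+1 F != [::] by rewrite -size_eq0 size_takel.
  case: o {IHN}; [|apply/suppMz]; apply/supp_gen;
    rewrite /= take_subseq drop_subseq tj dj size_drop size_takel //=; lia.
rewrite cup_recS; apply: (supp_lin (P := face_pair F m)); last first.
  by move=> t; apply: contr_supp.
apply: suppD.
  rewrite (lin_face_perm1 (IHN m F F0)).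
  apply: suppD; last exact/suppMz/IHN.
  by apply: (supp_lin (IHN m F F0)) => t; apply: face_perm_tau_supp.
apply/suppMz/lin_face_bd_supp => G; exact: IHN.
Qed.

(** Two faces of [F] have total dimension at most 2 dim F, which is less than m + dim F as soon as m
    exceeds dim F. *)
Lemma cup_small o N m (F : seq nat) :
  F != [::] -> (size F <= m)%N -> cup_rec o N m F = 0.
Proof.
move=> F0 Fm; apply: (@supp_ext _ _ pred0 idfun \0) => [t _|//].
have [pt|] := boolP (face_pair F m t); last exact: cup_supp.
case: t pt => [|A [|B [|//]]] //= /and5P[/size_subseq sA /size_subseq sB _ _ /eqP sAB].
by have := leq_add sA sB; rewrite sAB ltn_add2r ltnNge Fm.
Qed.

Lemma coeff_face_perm_tau F m u A B : supp (face_pair F m) u ->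
  coeff [:: A; B] (lin (face_perm tau) u)
  = sgn ((size A).-1 * (size B).-1) *~ coeff [:: B; A] u.
Proof.
move=> um; rewrite -lin_delta.
apply: (supp_ext (g := coeff [:: A; B] \o lin (face_perm tau)) um).
move=> -[|A' [|B' [|//]]] // _.
rewrite /= !lin_gen face_perm_tau raddfMz /= coeff_fgen.
rewrite !eqseq_cons andbCA !andbT [X in if X then _ else _]andbC.
by case: eqP => [->|_]; case: eqP => [->|_]; rewrite ?mul0rz //= mulrzz mul1r.
Qed.

Lemma subseq_size_eq (T : eqType) (X Y : seq T) :
  subseq X Y -> (size Y <= size X)%N -> X = Y.
Proof. by move=> XY YX; apply/eqP; rewrite -(geq_leqif (size_subseq_leqif XY)). Qed.

(** * The face opposite to the last vertex *)

Section LastFace.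
Context (G : seq nat) (v : nat).
Hypotheses (G0 : G != [::]) (vG : v \notin G).
Let F := rcons G v.

Let last_G : last 0%N G != v.
Proof.
by case: G G0 vG => //= a G' _; apply: contra => /eqP <-; exact: mem_last.
Qed.

Lemma face_neq B : last 0%N B = v -> (B == G) = false.
Proof. by move=> Bv; apply: contraNF last_G => /eqP <-; apply/eqP. Qed.

(** The total dimension is one less than that of F (x) F. A first factor not ending in [v] is a face
    of [G], which forces the word G (x) F; the second summand of the contraction would need a word
    of smaller dimension. *)
Lemma contr_top (t : seq (seq nat)) : face_pair F (size G).-1 t ->
  contr v t = if t == [:: G; F] then fgen [:: F; F] *~ sgn (size G) else 0.
Proof.
case: t => [|A [|B [|//]]] // /and5P[AF BF A0 B0 /eqP].
rewrite size_rcons => sAB.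
have sG : (0 < size G)%N by rewrite lt0n size_eq0.
have sB := size_subseq BF; rewrite size_rcons in sB.
rewrite contr2 [X in _ + X]ifF ?addr0; last first.
  apply/negP => /andP[/eqP A1 Bv].
  have := size_subseq (subseq_rcons_last B0 Bv BF).
  by move: A1 sAB sG; move: (size A) (size B) (size G) => a b g; lia.
have [Av|Av] := eqVneq; first by rewrite eqseq_cons face_neq.
have AG := subseq_rcons_last A0 Av AF.
have -> : A = G.
  apply: (subseq_size_eq AG).
  by move: sAB sG sB; move: (size A) (size B) (size G) => a b g; lia.
have -> : B = F.
  apply: (subseq_size_eq BF); rewrite size_rcons; have := size_subseq AG.
  by move: sAB sG; move: (size A) (size B) (size G) => a b g; lia.
by rewrite eqxx.
Qed.

Lemma contr_supp_last t :
  supp (fun t => last 0%N (head [::] t) == v) (contr v t).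
Proof.
case: t => [|A t] /=; first exact: supp0.
apply: suppD; last first.
  case: ifP => _; last exact: supp0.
  by apply: (supp_lin (P := predT)) => // t' _; apply: supp_gen => /=.
apply: (supp_lin (P := fun B => last 0%N B == v)) => [|B Bv]; last exact: supp_gen.
rewrite /cone; case: ifP => _; first exact: supp0.
by apply/suppMz/supp_gen; rewrite last_rcons.
Qed.

Lemma coeff_lin_contr_front B u : coeff [:: G; B] (lin (contr v) u) = 0.
Proof.
have : supp (fun t => last 0%N (head [::] t) == v) (lin (contr v) u).
  by apply: (supp_lin (P := predT)) => // t _; exact: contr_supp_last.
by apply; exact: last_G.
Qed.

(** Only the summand coning the first factor can give F (x) G, since the other one starts with the
    single vertex [v] and [F] has at least two vertices. *)
Lemma coeff_contr_diag t m : face_pair F m t ->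
  coeff [:: F; G] (contr v t) = if t == [:: G; G] then sgn (size G) else 0.
Proof.
case: t => [|A [|B [|//]]] // _.
rewrite contr2 raddfD /= [X in _ + X](_ : _ = 0) ?addr0.
  have [Av|Av] := eqVneq; first by rewrite eqseq_cons face_neq ?raddf0.
  rewrite raddfMz /= coeff_fgen !eqseq_cons eqseq_rcons !eqxx andbT.
  by case: (A =P G) => [->|_] /=; case: (B =P G) => //= _;
    rewrite mulrzz ?mul1r ?mul0r.
case: ifP => _; last exact: raddf0.
rewrite raddfMz /= coeff_fgen eqseq_cons (_ : ([:: v] == F) = false) ?mul0rz //.
apply/negP => /eqP/(congr1 size); rewrite size_rcons => -[] /esym/size0nil.
exact/eqP.
Qed.
End LastFace.

(** * The top coefficient, by induction on the dimension *)

Lemma sgn_neq0 n : sgn n != 0.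
Proof. by rewrite /sgn signr_eq0. Qed.

Lemma face_bd_rcons (G : seq nat) v : G != [::] ->
  face_bd (rcons G v)
  = \sum_(i < size G) fgen (rcons (take i G ++ drop i.+1 G) v) *~ sgn i
    + fgen G *~ sgn (size G).
Proof.
move=> G0; rewrite /face_bd size_rcons ltnS leqn0 size_eq0 (negbTE G0).
rewrite big_ord_recr /=; congr (_ + _).
  apply: eq_bigr => i _; congr (fgen _ *~ _).
  have iG := ltn_ord i.
  rewrite -!cats1 takel_cat ?(ltnW iG) // -catA; congr (_ ++ _).
  (* For the last i the cut falls exactly between [G] and [v]. *)
  rewrite drop_cat; case: ifP => // /negbT; rewrite -leqNgt => Gi.
  have -> : i.+1 = size G by apply/eqP; rewrite eqn_leq iG Gi.
  by rewrite subnn drop0 drop_size.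
by rewrite -cats1 take_size_cat // drop_oversize ?cats0 // size_cat addn1.
Qed.

(** For m > 0 the first factors end in [v]; for m = 0 one of the two factors is a back face, which
    contains [v]. *)
Lemma coeff_cup_diag o N m (G : seq nat) v : G != [::] -> v \notin G ->
  coeff [:: G; G] (cup_rec o N m (rcons G v)) = 0.
Proof.
move=> G0 vG; case: N => [|N]; first exact: raddf0.
case: m => [|m]; last first.
  by rewrite cup_recS last_rcons coeff_lin_contr_front.
rewrite /cup_rec -[smith_rec _ _ _ _]/(alexander_whitney o 2 (rcons G v)).
rewrite alexander_whitney2 raddf_sum big1 // => j _.
have dG : (drop j (rcons G v) == G) = false.
  apply/eqP => dG; move: vG; rewrite -dG => /negP; apply.
  rewrite drop_rcons ?mem_rcons ?inE ?eqxx //.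
  by rewrite -ltnS -(size_rcons G v) ltn_ord.
by case: o; rewrite ?raddfMz /= coeff_fgen !eqseq_cons dG ?andbF ?mul0rz.
Qed.

(** Here m is the dimension of [F], so cup-m vanishes on the boundary by [cup_small]. By [contr_top]
    only the coefficient of G (x) F counts, in [u] and in its transpose. *)
Lemma cup_top_step o N (G : seq nat) v :
  G != [::] -> v \notin G ->
  let F := rcons G v in let u := cup_rec o N (size G).-1 F in
  cup_rec o N.+1 (size G) F
  = fgen [:: F; F] *~ (sgn (size G)
      * (sgn ((size G).-1 * (size G)) * coeff [:: F; G] u
         + sgn (size G) * coeff [:: G; F] u)).
Proof.
move=> G0 vG F u.
have F0 : F != [::] by rewrite -size_eq0 size_rcons.
have sG : (size G).-1.+1 = size G by rewrite prednK // lt0n size_eq0.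
have uF : supp (face_pair F (size G).-1) u by exact: cup_supp.
rewrite -[in LHS]sG cup_recS last_rcons -/u.
rewrite [lin (cup_rec _ _ _) _](_ : _ = 0); last first.
  rewrite (supp_ext (h := \0) (face_bd_supp (F := F))) // => H /and3P[_ H0 /eqP sH] /=.
  by rewrite lin_gen cup_small //; move: sH; rewrite size_rcons sG => -[->].
rewrite mul0rz addr0 (lin_face_perm1 uF) sG.
set w := _ + _.
have wF : supp (face_pair F (size G).-1) w.
  apply: suppD; last exact: suppMz.
  by apply: (supp_lin uF) => t; apply: face_perm_tau_supp.
have -> : lin (contr v) w = fgen [:: F; F] *~ (sgn (size G) * coeff [:: G; F] w).
  rewrite mulrzA -lin_delta.
  by apply: (supp_ext wF) => t; rewrite /= !lin_gen; exact: contr_top.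
rewrite raddfD raddfMz /= (coeff_face_perm_tau _ _ uF) size_rcons /=.
by rewrite !mulrzz [coeff [:: G; F] _ * _]mulrC.
Qed.

(** F (x) G arises only from G (x) G, which by [coeff_cup_diag] occurs neither in cup-m of [F] nor
    in its transpose; the boundary term is left. *)
Lemma coeff_cup_back o N m (G : seq nat) v :
  G != [::] -> v \notin G ->
  let F := rcons G v in
  coeff [:: F; G] (cup_rec o N.+1 m.+1 F)
  = sgn (size G)
    * (sgn m.+1 * coeff [:: G; G] (lin (cup_rec o N m.+1) (face_bd F))).
Proof.
move=> G0 vG F.
have F0 : F != [::] by rewrite -size_eq0 size_rcons.
rewrite cup_recS last_rcons; set u := cup_rec _ _ _ _; set w := _ + _.
have uF : supp (face_pair F m) u by exact: cup_supp.
have wF : supp (face_pair F m) w.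
  rewrite /w (lin_face_perm1 uF); apply: suppD; [apply: suppD|]; last first.
  - by apply/suppMz/lin_face_bd_supp => H; exact: cup_supp.
  - exact: suppMz.
  by apply: (supp_lin uF) => t; apply: face_perm_tau_supp.
have -> : coeff [:: F; G] (lin (contr v) w) = sgn (size G) *~ coeff [:: G; G] w.
  rewrite -lin_delta; apply: (supp_ext (g := coeff _ \o lin (contr v)) wF) => t tF.
  by rewrite /= !lin_gen (coeff_contr_diag G0 vG tF).
rewrite /w !raddfD !raddfMz /= (lin_face_perm1 uF).
rewrite (coeff_face_perm_tau _ _ uF) !coeff_cup_diag // !(mulr0z, mul0rz, add0r).
by rewrite !mulrzz -mulrA; congr (_ * _); rewrite mulrC.
Qed.

(** Each dimension uses two units of fuel, one for [cup_top_step] and one for [coeff_cup_back],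
    hence [k.*2]. *)
Lemma cup_top o k r (F : seq nat) : uniq F -> size F = k.+1 ->
  exists2 s : int, s != 0 &
    cup_rec o (k.*2 + r.+1) k F = fgen [:: F; F] *~ s.
Proof.
elim: k r F => [|k IHk] r F.
  case: F => [|v [|//]] // _ _; exists 1 => //.
  rewrite /cup_rec -[smith_rec _ _ _ _]/(alexander_whitney o 2 [:: v]).
  by rewrite alexander_whitney2 big_ord_recl big_ord0 addr0 mulr1z; case: (o).
case/lastP: F => // G v; rewrite rcons_uniq size_rcons => /andP[vG uG] [sG].
have G0 : G != [::] by rewrite -size_eq0 sG.
rewrite doubleS !addSn -sG cup_top_step // sG /=.
eexists; last by [].
apply: mulf_neq0 (sgn_neq0 _) _.
(* For an edge, [u] is the Alexander-Whitney coproduct; it contains exactly one of G (x) F and F (x)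
   G, depending on [o]. *)
case: k IHk sG => [|k] IHk sG.
  case: G => [|a [|//]] // in vG uG {G0} sG *.
  have av : (v == a) = false by move: vG; rewrite inE => /negbTE.
  rewrite /cup_rec -[smith_rec _ _ _ _]/(alexander_whitney o 2 [:: a; v]).
  rewrite alexander_whitney2 !big_ord_recl big_ord0 addr0 /=.
  by case: (o); rewrite ?raddfD ?raddfMz /= !coeff_fgen !eqseq_cons !eqxx /=
    ?av ?(eq_sym a) ?av ?andbF ?mulr0z.
(* In higher dimension G (x) F does not occur in [u], and F (x) G comes from the boundary. *)
rewrite cup_recS last_rcons (coeff_lin_contr_front G0 vG) mulr0 addr0.
rewrite -[X in lin (contr X)](last_rcons 0%N G v) -cup_recS.
rewrite coeff_cup_back //.
apply: mulf_neq0 (sgn_neq0 _) (mulf_neq0 (sgn_neq0 _) (mulf_neq0 (sgn_neq0 _) _)).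
(* By induction a facet H contributes a multiple of H (x) H, so G (x) G comes from [G] alone. *)
rewrite face_bd_rcons // raddfD raddf_sum /= raddfD raddf_sum /= big1 ?add0r => [|i _].
  rewrite !raddfMz /= lin_gen mulrzz mulf_neq0 ?sgn_neq0 //.
  have [s s0 ->] := IHk r G uG sG.
  by rewrite raddfMz /= coeff_fgen eqxx mulrzz mul1r.
rewrite !raddfMz /= lin_gen.
set H := rcons _ v.
have sH : size H = k.+2.
  by rewrite -sG size_rcons -size_drop_nth.
have uH : uniq H.
  have GG := subseq_drop_nth G i; rewrite rcons_uniq (subseq_uniq GG uG) andbT.
  by apply: contra vG; exact: mem_subseq.
have [s s0 ->] := IHk r H uH sH.
rewrite raddfMz /= coeff_fgen eqseq_cons (face_neq G0 vG) ?last_rcons //.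
by rewrite !mul0rz.
Qed.

Lemma smith_top o k : exists2 s : int, s != 0 &
  smith o (nseq k tau) (iota 0 k.+1) = fgen [:: iota 0 k.+1; iota 0 k.+1] *~ s.
Proof.
(* The value r = 1 matches the fuel k + (k + 1) + 1 of [smith]. *)
have [s s0 sE] := cup_top o 1 (iota_uniq 0 k.+1) (size_iota 0 k.+1).
exists s => //; rewrite -sE /smith /cup_rec size_nseq size_iota.
by congr smith_rec; rewrite -addnn; lia.
Qed.

(** * Passage to the chains of a simplicial set *)

Section TopSimplex.
Context (o : aw_order) (X : psset) (m : nat).

(** The dimension of the face with vertices [iota 0 m.+1] equals m only propositionally, hence two
    indices and an equality of homogeneous elements. *)
Lemma el_simp_res n (f : mono n m) (x : X m) :
  n = m -> (forall i, val f i = i :> nat) ->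
  @el (chain_cx X) (Posz n) (simp (sres f x))
  = @el (chain_cx X) (Posz m) (simp x).
Proof.
move=> nm; subst n => fid; have -> : f = mid m.
  by apply: mono_ext => i; apply: val_inj; apply: etrans (fid i) _; rewrite ffunE.
by rewrite sres_id.
Qed.

Lemma face_el_top (x : X m) :
  face_el x (iota 0 m.+1) = @el (chain_cx X) (Posz m) (simp x).
Proof.
apply: el_simp_res; first by rewrite size_iota.
have lt_m (i : 'I_(size (iota 0 m.+1)).-1.+1) : (i < m.+1)%N.
  by apply: leq_trans (ltn_ord i) _; rewrite size_iota.
(* The vertex list is increasing, so [insubd] does not return its default. *)
move=> i; rewrite /face_incl val_insubd ifT; last first.
  apply/forallP => a; apply/forallP => b; apply/implyP => ab.
  by rewrite !ffunE !nth_iota // !add0n !inordK.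
by rewrite ffunE nth_iota // add0n inordK.
Qed.

Lemma smith_act_simp n (u : RS n) (x : X m) :
  (0 < m)%N && (x == spts X m) = false ->
  smith_act o X u (Posz m) (simp x) = smith_act_gen o x u.
Proof.
move=> xb; rewrite -[LHS]/(plin (fun x : X m => smith_act_gen o x u) (simp x)).
by rewrite plin_gen xb.
Qed.

Lemma smith_act_top : exists2 s : int, s != 0 &
  forall x : X m, (0 < m)%N && (x == spts X m) = false ->
  smith_act o X (bar 1%g (nseq m tau)) (Posz m) (simp x)
  = (let e := @el (chain_cx X) (Posz m) (simp x) in tens 2 [:: e; e]) *~ s.
Proof.
have [s s0 sE] := smith_top o m; exists s => // x xb.
rewrite smith_act_simp // /smith_act_gen plin_gen /= (negbTE (tau_free m)).
by rewrite sE !raddfMz /= !lin_gen face_perm1 lin_gen /= face_el_top.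
Qed.
End TopSimplex.

(** * Linear independence by interpolation *)

Section Component.
Context (C : int -> zmodType) (k : int).

Definition component (e : elt C) : C k :=
  untag (T_ := fun j => C j) 0 (fun x : C k => x) e.

Lemma component_el (x : C k) : component (el x) = x.
Proof. exact: (untagE (T_ := fun j => C j) 0 id (erefl : tag (el x) = k)). Qed.

Lemma component_elD j (a b : C j) :
  component (el (a + b)) = component (el a) + component (el b).
Proof.
have [jk|jk] := eqVneq j k; first by subst j; rewrite !component_el.
by rewrite /component !untag_dflt ?addr0.
Qed.

Context (f : {additive C k -> int}).

(* f (x) 1, where [f] is extended by zero to the degrees other than [k] *)
Definition slant : tpow C 2 -> C k := tlift (fun t =>
  component (nth (el0 C) t 1) *~ f (component (nth (el0 C) t 0))).

Lemma slant_multilin : multilin 2 (fun t : seq (elt C) =>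
  component (nth (el0 C) t 1) *~ f (component (nth (el0 C) t 0))).
Proof.
move=> s1 s2 j a b; case: s1 => [|x [|//]]; case: s2 => [|y [|//]] //= _.
  by rewrite component_elD raddfD mulrzDr.
by rewrite component_elD mulrzDl.
Qed.

HB.instance Definition _ := GRing.isZmodMorphism.Build _ _ slant
  (tlift_is_zmod_morphism slant_multilin).

Lemma slant_tens (x y : C k) : slant (tens 2 [:: el x; el y]) = y *~ f x.
Proof. by rewrite /slant tlift_tens //= ?component_el //; exact: slant_multilin. Qed.
End Component.

(* A Lagrange interpolation: the operators [U phi] act on the [p x] by the
   scalars [s * phi (p x)]. *)
Lemma diagonal_independent (T : eqType) (V : zmodType) (r : seq T)
    (p : T -> V) (c : T -> int) (s : int) :
  uniq r -> s != 0 ->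
  (forall phi : {additive V -> int}, exists U : {additive V -> V},
    forall x, U (p x) = p x *~ (s * phi (p x))) ->
  {in r &, forall x y, x != y ->
    exists phi : {additive V -> int}, phi (p x) != phi (p y)} ->
  {in r, forall x, exists phi : {additive V -> int}, phi (p x) != 0} ->
  \sum_(x <- r) p x *~ c x = 0 -> {in r, forall x, c x = 0}.
Proof.
move=> ur s0 opU sep nz rel x0 x0r.
(* [g x] is the product of the s (phi_y (p x) - phi_y (p y)) over the y other than [x0], where phi_y
   separates [x0] from y. Subtracting s phi_y (p y) times the relation from its image under the
   operator of phi_y multiplies the coefficients by such a factor. *)
have [g [g0 gr gE]] : exists g : T -> int,
    [/\ g x0 != 0, {in rem x0 r, forall x, g x = 0}
      & \sum_(x <- r) p x *~ (c x * g x) = 0].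
  have sub : {subset rem x0 r <= r} by exact: mem_rem.
  have : x0 \notin rem x0 r by rewrite mem_rem_uniqF.
  elim: (rem x0 r) sub => [_ _|y l IHl sub].
    exists (fun=> 1); split=> //; rewrite -[RHS]rel.
    by apply: eq_bigr => x _; rewrite mulr1.
  rewrite inE negb_or => /andP[x0y x0l].
  have [x lx|g [g0 gl gE]] := IHl _ x0l; first by apply: sub; rewrite inE lx orbT.
  have yr : y \in r by apply: sub; rewrite inE eqxx.
  have [phi phixy] := sep _ _ x0r yr x0y; have [U UE] := opU phi.
  exists (fun x => g x * (s * (phi (p x) - phi (p y)))); split.
  - by rewrite !mulf_neq0 // subr_eq0.
  - move=> x; rewrite inE => /predU1P[->|/gl ->]; last by rewrite mul0r.
    by rewrite subrr !mulr0.
  have := congr1 U gE; rewrite raddf0 raddf_sum => gU.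
  have := congr1 (fun v => v *~ (s * phi (p y))) gE.
  rewrite mul0rz mulrz_suml => gs; apply: etrans (subr0 0).
  rewrite -[X in X - _]gU -[X in _ - X]gs.
  rewrite -sumrB.
  apply: eq_bigr => x _; rewrite raddfMz /= UE -!mulrzA -mulrzBr.
  by congr (_ *~ _); ring.
(* [V] may have torsion, so the one remaining term is evaluated by a functional that is nonzero on
   it. *)
have [phi phi0] := nz _ x0r; have := congr1 phi gE.
rewrite (perm_big _ (perm_to_rem x0r)) big_cons /=.
rewrite (_ : \sum_(j <- rem x0 r) _ = 0); last first.
  by rewrite big1_seq // => x /andP[_ /gr ->]; rewrite mulr0.
rewrite addr0 raddf0 raddfMz /= mulrzz => /eqP.
by rewrite !mulf_eq0 (negbTE phi0) (negbTE g0) orbF => /eqP.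
Qed.

(** The only word of length 0 is empty and has degree 0. *)
Lemma thom0_eq0 (C : int -> zmodType) d (x : tpow C 0) : d != 0 -> thom d x -> x = 0.
Proof.
move=> d0 [u -> ud]; suff -> : u = 0 by exact: raddf0.
apply/eqP; rewrite -dom_eq0; case E: (dom u) => [//|t l].
have := ud t; rewrite E inE eqxx tuple0 /= big_nil => /(_ isT) d0E.
by rewrite -d0E eqxx in d0.
Qed.

(** * Injectivity *)

Section CeilDegree.
Context (P : precoalg) (Pc : is_coalg P) (k : int) (k0 : k != 0).

Lemma augm_eq0 (x : P k) : augm P k x = 0.
Proof. by apply: (thom0_eq0 k0); have := act_deg Pc (1%g : 'S_0) [::] x; rewrite addr0. Qed.

Definition to_ceil (x : P k) : ceil P k := ker_in (augm_eq0 x).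

Lemma to_ceil_is_zmod_morphism : zmod_morphism to_ceil.
Proof. by move=> x y; apply: val_inj. Qed.
HB.instance Definition _ :=
  GRing.isZmodMorphism.Build _ _ to_ceil to_ceil_is_zmod_morphism.
End CeilDegree.

(** * Separating the simplices of Gamma D *)

Section DoldKanEval.
Context (D : chcx) (n p : nat) (s : mono p n).

Definition dk_eval (x : dold_kan D n) : D (Posz p) := dk_val x s.

Lemma dk_eval_is_zmod_morphism : zmod_morphism dk_eval.
Proof. by []. Qed.
HB.instance Definition _ :=
  GRing.isZmodMorphism.Build _ _ dk_eval dk_eval_is_zmod_morphism.
End DoldKanEval.

(** Distinct simplices have distinct values at some [s], in a free group, where some coordinate
    tells them apart. *)
Lemma dk_separated (D : chcx) (n : nat) (x y : dold_kan D n) :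
  zfree_cx D -> x <> y ->
  exists phi : {additive dold_kan D n -> int}, phi x != phi y.
Proof.
move=> Dfree xy; apply: contrapT => nphi; apply: xy; apply: dk_ext => p s.
have [T [h /bij_inj hI]] := Dfree (Posz p); apply: hI.
apply/eqP/freeg_eqP => t; apply/eqP; apply: contrapT => /negP xyt; apply: nphi.
by exists (coeff t \o (h \o dk_eval s)).
Qed.

(** The value at p = 0 lies in D_0 = 0, and for p > 0 every map from [p] to [0] is degenerate. *)
Lemma dk0_eq0 (D : chcx) (x : dold_kan D 0) : positive_cx D -> x = 0.
Proof.
move=> Dpos; apply: dk_ext => -[|p] s; first exact: Dpos.
have [x0 _] := dk_valP x; rewrite x0 //.
apply/negP => /injectiveP /(_ ord0 ord_max) /=.
by rewrite !ord1 => /(_ erefl) /(congr1 val).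
Qed.

Lemma tmap_mulrz (C P : int -> zmodType) n (g : forall k, {additive C k -> P k})
  (x : tpow C n) z : tmap g (x *~ z) = tmap g x *~ z.
Proof.
pose T : {additive tpow C n -> tpow P n} := HB.pack (tmap g)
  (GRing.isZmodMorphism.Build _ _ _
     (tlift_is_zmod_morphism (@tmap_multilin C P n g))).
exact: (raddfMz T).
Qed.

Lemma tmap_tens2 (C P : int -> zmodType) (g : forall k, {additive C k -> P k})
  k (x y : C k) :
  tmap g (tens 2 [:: el x; el y]) = tens 2 [:: el (g k x); el (g k y)].
Proof. by rewrite /tmap tlift_tens //; exact: tmap_multilin. Qed.

(** In arity 0 the constant function 1 is vacuously multilinear, and the map it induces sends the
    empty tensor to 1. *)
Lemma tens0_mulrz_inj (C : int -> zmodType) (n : int) :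
  tens 0 [::] *~ n = 0 :> tpow C 0 -> n = 0.
Proof.
have ml : multilin 0 (fun _ : seq (elt C) => 1 : int) by move=> ? ? ? ?.
pose T : {additive tpow C 0 -> int} := HB.pack (tlift _)
  (GRing.isZmodMorphism.Build _ _ _ (tlift_is_zmod_morphism ml)).
move=> /(congr1 T); rewrite raddf0 raddfMz /= tlift_tens //.
by rewrite mulrzz mul1r.
Qed.

(** * The classifying map *)

Section Injectivity.
Context (o : aw_order) (D : chcx) (P : precoalg) (Pc : is_coalg P).
Context (eps : chmap (ceil P) (moore (dold_kan D))).
Local Notation C := (smith_coalg o (upsset (dold_kan D))).
Local Notation basis m :=
  {x : dold_kan D m | ~~ ((0 < m)%N && (x == spts (upsset (dold_kan D)) m))}.
Context (gamma : comorph C P).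
Hypothesis gammaE : classifies eps (collapse o (dold_kan D)) gamma.

Lemma gamma_inj0 : positive_cx D -> injective (gamma (Posz 0)).
Proof.
move=> Dpos; apply: raddf_inj => c gc0.
have all_eq (y z : basis 0) : y = z.
  by apply: val_inj; rewrite [LHS]dk0_eq0 // [RHS]dk0_eq0.
pose y0 : basis 0 := exist _ 0 isT.
have cE : c = fgen y0 *~ coeff y0 c.
  apply/eqP/freeg_eqP => y; rewrite (all_eq y y0) raddfMz /= coeff_fgen eqxx.
  by rewrite mulrzz mul1r.
suff n0 : coeff y0 c = 0 by rewrite cE n0 mulr0z.
apply: (@tens0_mulrz_inj P).
(* The vertex has augmentation 1, and [gamma] preserves augmentations. *)
have gy : act P (bar 1%g [::] : RS 0) 0 (gamma (Posz 0) (fgen y0)) = tens 0 [::].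
  rewrite cmo_act.
  have -> : act C (bar 1%g [::] : RS 0) (Posz 0) (fgen y0) = tens 0 [::].
    rewrite -pgen_val; apply: etrans (smith_act_simp _ _ _) _ => //.
    by rewrite smith_act_gen0.
  by rewrite /tmap tlift_tens //; exact: tmap_multilin.
rewrite -gy -raddfMz /= -raddfMz -cE.
by rewrite [gamma _ _]gc0 raddf0.
Qed.

(** In positive degree all chains have augmentation 0, so the equation defining [gamma] applies to
    each of them. *)
Lemma eps_gamma m (c : C (Posz m.+1)) :
  eps (Posz m.+1) (to_ceil Pc (isT : Posz m.+1 != 0) (gamma (Posz m.+1) c))
  = collapse_cm (dold_kan D) (Posz m.+1) c.
Proof.
have c0 : augm C (Posz m.+1) c = 0.
  apply: (@plin_ext _ _ _ (augm C (Posz m.+1)) \0 _ c) => x.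
  have [xb|xb] := boolP ((0 < m.+1)%N && (x == spts (upsset (dold_kan D)) m.+1)).
    by rewrite pgen0 // !raddf0.
  apply: etrans (smith_act_simp _ _ (negbTE xb)) _.
  by rewrite smith_act_gen0.
rewrite -[RHS](gammaE (ker_in c0)); congr (eps _ _).
exact: val_inj.
Qed.

Lemma gamma_inj_pos m : zfree_cx D -> injective (gamma (Posz m.+1)).
Proof.
move=> Dfree; apply: raddf_inj => c gc0.
have [s s0 sE] := smith_act_top o (upsset (dold_kan D)) m.+1.
pose p (y : basis m.+1) : P (Posz m.+1) := gamma (Posz m.+1) (fgen y).
pose E : {additive P (Posz m.+1) -> dold_kan D m.+1} :=
  eps (Posz m.+1) \o to_ceil Pc (isT : Posz m.+1 != 0).
have pE y : E (p y) = val y.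
  rewrite [LHS]eps_gamma -pgen_val.
  exact: (@collapse_simp (dold_kan D) m.+1 (val y)).
have {}sE y : act P (bar 1%g (nseq m.+1 tau)) (Posz m.+1) (p y)
    = tens 2 [:: el (p y); el (p y)] *~ s.
  rewrite /p cmo_act -pgen_val [X in tmap _ X](sE _ (negbTE (valP y))).
  rewrite tmap_mulrz; congr (_ *~ _); exact: tmap_tens2.
have : {in dom c, forall y, coeff y c = 0}.
  apply: (@diagonal_independent _ _ _ p _ s) => //.
  - exact: uniq_dom.
  - move=> phi; exists (slant phi \o act P (bar 1%g (nseq m.+1 tau)) (Posz m.+1)) => y.
    by rewrite /= sE raddfMz /= slant_tens -mulrzA mulrC.
  - move=> y z _ _ yz; have [] := @dk_separated D m.+1 (val y) (val z) Dfree.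
      by move/val_inj/eqP; apply/negP.
    by move=> psi; rewrite -!pE => psiyz; exists (psi \o E).
  (* In positive dimension the basepoint 0 is not in the basis, so a functional separates the
     simplex from 0. *)
  - move=> y _; have [] := @dk_separated D m.+1 (val y) 0 Dfree.
      move=> y0; have := valP y; rewrite y0 => /negP; apply.
      by apply/eqP; apply: esym; exact: (raddf0 (ares (dold_kan D) (mconst m.+1))).
    by move=> psi; rewrite raddf0 -pE => psiy; exists (psi \o E).
  rewrite -[RHS]gc0 [c in RHS]fg_sum raddf_sum.
  by apply: eq_bigr => y _; rewrite raddfMz.
move=> c0; apply/eqP; rewrite -dom_eq0; case Ed: (dom c) => [//|y l].
have yd : y \in dom c by rewrite Ed inE eqxx.
by have := yd; rewrite mem_dom c0 ?eqxx.
Qed.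
End Injectivity.

Theorem theorem3p12 (o : aw_order) (D : chcx)
    (Dfree : zfree_cx D) (Dpos : positive_cx D)
    (P : precoalg) (eps : chmap (ceil P) (moore (dold_kan D)))
    (Pcofree : is_cofree eps)
    (gammaD : comorph (smith_coalg o (upsset (dold_kan D))) P)
    (gammaDc : classifies eps (collapse o (dold_kan D)) gammaD) :
  forall k : int, injective (gammaD k).
Proof.
have [[Pc _] _] := Pcofree.
case=> [[|m]|m].
- exact: gamma_inj0.
- exact: (gamma_inj_pos Pc gammaDc).
- by move=> x y _; rewrite [x]triv0 [y]triv0.
Qed.
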